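(* Let $K$ be a simplicial complex with $n$ vertices. If $A\subset X\subset Y$ with $A$ discrete and $X$, $Y$ path-connected, such that the inclusion $X\hookrightarrow Y$ induces an isomorphism of the fundamental groups of $X$ and $Y$, then there is an isomorphism $$\pi_1(Z_K(X,A))\cong\pi_1(Z_K(Y,A)).$$
   Context: A simplicial complex $K$ with $n$ vertices is a collection of subsets of $[n]=\{1,\dots,n\}$, closed under taking subsets, containing $\varnothing$ and every singleton $\{i\}$. The pairs $(X,A)$ and $(Y,A)$ are pointed CW-pairs (with common basepoint in $A$), and $X\subset Y$ is an inclusion of CW-complexes. For a pair $(X,A)$ the polyhedral product is $$Z_K(X,A)=\bigcup_{\sigma\in K}D(\sigma)\subseteq X^n,\qquad D(\sigma)=\prod_{i=1}^n Y_i,\quad Y_i=X \text{ if } i\in\sigma,\ Y_i=A\text{ if } i\notin\sigma,$$ and similarly for $(Y,A)$. *)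

(* Defs.v *)
From HB Require Import structures.
From mathcomp Require Import all_boot all_order all_algebra generic_quotient.
From mathcomp Require Import all_classical all_reals all_analysis homotopy.
From mathcomp Require Import lra.
Set Implicit Arguments.
Unset Strict Implicit.
Unset Printing Implicit Defensive.
Import Order.TTheory GRing.Theory Num.Theory.
Import numFieldNormedType.Exports.

Local Open Scope classical_set_scope.
Local Open Scope ring_scope.
Local Open Scope quotient_scope.

Section unit_interval.
Context (R : realType).

Definition unit_interval : Type := set_type `[0 : R, 1]%classic.

HB.instance Definition _ := Topological.copy unit_interval
  (set_type `[0 : R, 1]%classic).

Implicit Types t : R.

Fact clamp_subproof t : Num.max 0 (Num.min 1 t) \in `[0 : R, 1]%classic.
Proof.
apply/mem_set; rewrite /= in_itv /= le_max lexx /=.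
by rewrite ge_max ler01 ge_min lexx.
Qed.

(* the nearest point of the unit interval *)
Definition clamp t : unit_interval := exist _ (Num.max 0 (Num.min 1 t)) (clamp_subproof t).

Definition ival (i : unit_interval) : R := set_val i.

Lemma ival_ge0 i : 0 <= ival i.
Proof. by have := set_valP i; rewrite /= in_itv => /andP[]. Qed.

Lemma ival_le1 i : ival i <= 1.
Proof. by have := set_valP i; rewrite /= in_itv => /andP[]. Qed.

Lemma ival_inj : injective ival.
Proof. exact: val_inj. Qed.

Lemma clampK t : 0 <= t <= 1 -> ival (clamp t) = t.
Proof.
move=> /andP[t0 t1]; rewrite /ival /clamp set_valE /=.
by rewrite (min_idPr t1) (max_idPr t0).
Qed.

Lemma ivalK i : clamp (ival i) = i.
Proof. by apply: ival_inj; rewrite clampK// ival_ge0 ival_le1. Qed.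

Lemma clamp_ex i : exists t, [/\ 0 <= t, t <= 1 & i = clamp t].
Proof. by exists (ival i); rewrite ival_ge0 ival_le1 ivalK. Qed.

Lemma ival_continuous : continuous ival.
Proof. exact: initial_continuous. Qed.

Lemma clamp_continuous : continuous clamp.
Proof.
apply/continuous_comp_initial => t.
have -> : set_val \o clamp = fun t => Num.max 0 (Num.min 1 t) by [].
apply: continuous_max; first exact: cvg_cst.
by apply: continuous_min; [exact: cvg_cst | exact: cvg_id].
Qed.

Fact unit_interval_neq : clamp 0 != clamp 1.
Proof.
apply/eqP => /(congr1 ival); rewrite !clampK ?lexx ?ler01//.
by move/esym/eqP; rewrite oner_eq0.
Qed.

HB.instance Definition _ := isBiPointed.Build unit_interval unit_interval_neq.

Lemma ival0 : ival zero = 0. Proof. by rewrite clampK// lexx ler01. Qed.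
Lemma ival1 : ival one = 1. Proof. by rewrite clampK// lexx ler01. Qed.

End unit_interval.

Lemma comp_continuous (S A B : topologicalType) (g : A -> B) (f : S -> A) :
  continuous g -> continuous f -> continuous (fun s => g (f s)).
Proof.
move=> gc fc s; apply: (@continuous_comp _ _ _ f g); first exact: fc.
exact: gc.
Qed.

Lemma comp_pair_continuous (S A B T : topologicalType) (H : A * B -> T)
    (f : S -> A) (g : S -> B) :
  continuous H -> continuous f -> continuous g ->
  continuous (fun s => H (f s, g s)).
Proof.
move=> Hc fc gc s.
apply: (@continuous_comp _ _ _ (fun s => (f s, g s)) H); last exact: Hc.
have F : Filter (nbhs s) by exact: nbhs_filter.
exact: (@cvg_pair _ _ _ _ _ _ F _ _ f g (fc s) (gc s)).
Qed.

Lemma if_le_continuous (R : realType) (S T : topologicalType) (h : S -> R)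
    (c : R) (u v : S -> T) :
  continuous h -> continuous u -> continuous v ->
  (forall s, h s = c -> u s = v s) ->
  continuous (fun s => if h s <= c then u s else v s).
Proof.
move=> hc uc vc uv; apply/continuous_closedP => C clC.
rewrite [X in closed X](_ : _ =
  ((h @^-1` [set r | r <= c]) `&` (u @^-1` C)) `|`
  ((h @^-1` [set r | c <= r]) `&` (v @^-1` C))); last first.
  apply/seteqP; split => s /=.
    by case: leP => [hs Cs|/ltW hs Cs]; [left|right].
  case: leP => hs [[hs' Cs]|[hs' Cs]] //.
  by rewrite uv //; apply/le_anti; rewrite hs hs'.
apply: closedU; apply: closedI.
- by apply: preimage_closed => //; exact: closed_le.
- exact: preimage_closed.
- by apply: preimage_closed => //; exact: closed_ge.
- exact: preimage_closed.
Qed.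

Section real_functions.
Context {R : realType} {S : topologicalType}.
Implicit Types f g : S -> R.

Lemma cst_real_continuous (a : R) : continuous (fun _ : S => a).
Proof. by move=> s; apply: cvg_cst. Qed.

Lemma add_real_continuous f g : continuous f -> continuous g ->
  continuous (fun s => f s + g s).
Proof. by move=> fc gc s; apply: cvgD; [exact: fc | exact: gc]. Qed.

Lemma sub_real_continuous f g : continuous f -> continuous g ->
  continuous (fun s => f s - g s).
Proof. by move=> fc gc s; apply: cvgB; [exact: fc | exact: gc]. Qed.

Lemma mul_real_continuous f g : continuous f -> continuous g ->
  continuous (fun s => f s * g s).
Proof. by move=> fc gc s; apply: cvgM; [exact: fc | exact: gc]. Qed.

Lemma min_real_continuous f g : continuous f -> continuous g ->
  continuous (fun s => Num.min (f s) (g s)).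
Proof. by move=> fc gc s; apply: continuous_min; [exact: fc | exact: gc]. Qed.

Lemma max_real_continuous f g : continuous f -> continuous g ->
  continuous (fun s => Num.max (f s) (g s)).
Proof. by move=> fc gc s; apply: continuous_max; [exact: fc | exact: gc]. Qed.

End real_functions.

Section path_operations.
Context {R : realType} {T : topologicalType}.
Local Notation I := (unit_interval R).
Implicit Types x y z : T.

Definition path_concat x y z (p : {path I from x to y in T})
    (q : {path I from y to z in T}) (t : I) : T :=
  if ival t <= 2^-1 then p (clamp (2 * ival t))
  else q (clamp (2 * ival t - 1)).

Definition path_inverse x y (p : {path I from x to y in T}) (t : I) : T :=
  p (clamp (1 - ival t)).

(* homotopy relative to the endpoints; the second variable is the homotopy
   parameter *)
Definition path_homotopic x y (p q : {path I from x to y in T}) : Prop :=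
  exists H : I * I -> T, [/\ continuous H,
    forall s, H (s, zero) = p s, forall s, H (s, one) = q s,
    forall t, H (zero, t) = x & forall t, H (one, t) = y].

Lemma clamp_comp_continuous (S : topologicalType) (f : S -> R) :
  continuous f -> continuous (fun s => clamp (f s)).
Proof.
move=> fc s; apply: (@continuous_comp _ _ _ f (@clamp R)); first exact: fc.
exact: clamp_continuous.
Qed.

Lemma path_comp_continuous (S : topologicalType) x y
    (p : {path I from x to y in T}) (f : S -> I) :
  continuous f -> continuous (fun s => p (f s)).
Proof.
move=> fc s; apply: (@continuous_comp _ _ _ f p); first exact: fc.
exact: cts_fun.
Qed.

Lemma ival_comp_continuous (S : topologicalType) (f : S -> I) :
  continuous f -> continuous (fun s => ival (f s)).
Proof.
move=> fc s; apply: (@continuous_comp _ _ _ f (@ival R)); first exact: fc.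
exact: ival_continuous.
Qed.

Lemma path0 x y (p : {path I from x to y in T}) : p (clamp 0) = x.
Proof. exact: path_zero. Qed.

Lemma path1 x y (p : {path I from x to y in T}) : p (clamp 1) = y.
Proof. exact: path_one. Qed.

Section concat.
Variables (x y z : T) (p : {path I from x to y in T}).
Variable (q : {path I from y to z in T}).

Fact path_concat_continuous : continuous (path_concat p q).
Proof.
apply: if_le_continuous.
- exact: ival_continuous.
- apply/path_comp_continuous/clamp_comp_continuous.
  apply: mul_real_continuous; first exact: cst_real_continuous.
  exact: ival_continuous.
- apply/path_comp_continuous/clamp_comp_continuous.
  apply: sub_real_continuous; last exact: cst_real_continuous.
  apply: mul_real_continuous; first exact: cst_real_continuous.
  exact: ival_continuous.
- by move=> s ->; rewrite divff ?pnatr_eq0// subrr path1 path0.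
Qed.

Lemma path_concatL (v : R) : 0 <= v <= 2^-1 ->
  path_concat p q (clamp v) = p (clamp (2 * v)).
Proof.
move=> /andP[v0 v1]; rewrite /path_concat clampK ?v1//.
by rewrite v0 /=; lra.
Qed.

Lemma path_concatR (v : R) : 2^-1 <= v <= 1 ->
  path_concat p q (clamp v) = q (clamp (2 * v - 1)).
Proof.
move=> /andP[v0 v1]; rewrite /path_concat clampK; last by rewrite v1 andbT; lra.
case: leP => // v2; have -> : v = 2^-1 by lra.
by rewrite divff ?pnatr_eq0// subrr path1 path0.
Qed.

Fact path_concat_zero : path_concat p q zero = x.
Proof. by rewrite path_concatL ?mulr0 ?path0// lexx invr_ge0 ler0n. Qed.

Fact path_concat_one : path_concat p q one = z.
Proof.
rewrite path_concatR; last by rewrite lexx andbT; lra.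
by rewrite (_ : 2 * 1 - 1 = 1) ?path1//; lra.
Qed.

HB.instance Definition _ :=
  isContinuous.Build I T (path_concat p q) path_concat_continuous.
HB.instance Definition _ :=
  isPath.Build I T x z (path_concat p q) path_concat_zero path_concat_one.

Fact path_inverse_continuous : continuous (path_inverse p).
Proof.
apply/path_comp_continuous/clamp_comp_continuous/sub_real_continuous.
  exact: cst_real_continuous.
exact: ival_continuous.
Qed.

Fact path_inverse_zero : path_inverse p zero = y.
Proof. by rewrite /path_inverse ival0 subr0 path1. Qed.

Fact path_inverse_one : path_inverse p one = x.
Proof. by rewrite /path_inverse ival1 subrr path0. Qed.

HB.instance Definition _ :=
  isContinuous.Build I T (path_inverse p) path_inverse_continuous.
HB.instance Definition _ :=
  isPath.Build I T y x (path_inverse p) path_inverse_zero path_inverse_one.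

End concat.

Section homotopy.
Variables (x y : T).
Implicit Types p q r : {path I from x to y in T}.

Lemma path_homotopic_refl p : path_homotopic p p.
Proof.
exists (fun st => p st.1); split=> [|//|//|t|t].
- by apply: path_comp_continuous => st; exact: cvg_fst.
- exact: path_zero.
- exact: path_one.
Qed.

Lemma path_homotopic_sym p q : path_homotopic p q -> path_homotopic q p.
Proof.
move=> [H [Hc H0 H1 Hx Hy]].
exists (fun st => H (st.1, clamp (1 - ival st.2))); split=> [|s|s|t|t] /=.
- apply: comp_pair_continuous => //; first by move=> st; exact: cvg_fst.
  apply: clamp_comp_continuous; apply: sub_real_continuous.
    exact: cst_real_continuous.
  by apply: ival_comp_continuous => ?; exact: cvg_snd.
- by rewrite ival0 subr0 -H1.
- by rewrite ival1 subrr -H0.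
- exact: Hx.
- exact: Hy.
Qed.

Lemma path_homotopic_trans p q r :
  path_homotopic p q -> path_homotopic q r -> path_homotopic p r.
Proof.
move=> [H [Hc H0 H1 Hx Hy]] [G [Gc G0 G1 Gx Gy]].
exists (fun st => if ival st.2 <= 2^-1 then H (st.1, clamp (2 * ival st.2))
  else G (st.1, clamp (2 * ival st.2 - 1))); split=> [|s|s|t|t] /=.
- have sc : continuous (fun st : I * I => ival st.2).
    by apply: ival_comp_continuous => ?; exact: cvg_snd.
  apply: if_le_continuous => //.
  + apply: comp_pair_continuous => //; first by move=> st; exact: cvg_fst.
    apply: clamp_comp_continuous; apply: mul_real_continuous => //.
    exact: cst_real_continuous.
  + apply: comp_pair_continuous => //; first by move=> st; exact: cvg_fst.
    apply: clamp_comp_continuous; apply: sub_real_continuous.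
      by apply: mul_real_continuous => //; exact: cst_real_continuous.
    exact: cst_real_continuous.
  + by move=> s ->; rewrite divff ?pnatr_eq0// subrr H1 G0.
- by rewrite ival0 invr_ge0 ler0n mulr0 -H0.
- rewrite ival1 ifF; last by apply/negP; lra.
  by rewrite (_ : 2 * 1 - 1 = 1) -?G1//; lra.
- by case: ifP.
- by case: ifP.
Qed.

Lemma path_homotopic_reparam p q (g : I -> T) (phi psi : I -> R) :
    continuous g -> continuous phi -> continuous psi ->
    phi zero = psi zero -> phi one = psi one ->
    (forall i, p i = g (clamp (phi i))) -> (forall i, q i = g (clamp (psi i))) ->
  path_homotopic p q.
Proof.
move=> gc phic psic e0 e1 pE qE.
exists (fun st => g (clamp (phi st.1 + ival st.2 * (psi st.1 - phi st.1)))).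
split=> [|s|s|t|t] /=.
- have fc (h : I -> R) : continuous h -> continuous (fun st : I * I => h st.1).
    move=> hc st; apply: (@continuous_comp _ _ _ fst h); last exact: hc.
    exact: cvg_fst.
  apply: comp_continuous => //; apply: clamp_comp_continuous; apply: add_real_continuous; first exact: fc.
  apply: mul_real_continuous.
    by apply: ival_comp_continuous => ?; exact: cvg_snd.
  by apply: sub_real_continuous; exact: fc.
- by rewrite ival0 mul0r addr0 pE.
- by rewrite ival1 mul1r subrKC qE.
- by rewrite e0 subrr mulr0 addr0 -qE path_zero.
- by rewrite e1 subrr mulr0 addr0 -qE path_one.
Qed.

End homotopy.

Lemma path_concat_homotopic x y z (p p' : {path I from x to y in T})
    (q q' : {path I from y to z in T}) :
  path_homotopic p p' -> path_homotopic q q' ->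
  path_homotopic (path_concat p q) (path_concat p' q').
Proof.
move=> [H [Hc H0 H1 Hx Hy]] [G [Gc G0 G1 Gx Gy]].
exists (fun st => if ival st.1 <= 2^-1 then H (clamp (2 * ival st.1), st.2)
  else G (clamp (2 * ival st.1 - 1), st.2)); split=> [|s|s|t|t] /=.
- have sc : continuous (fun st : I * I => ival st.1).
    by apply: ival_comp_continuous => ?; exact: cvg_fst.
  apply: if_le_continuous => //.
  + apply: comp_pair_continuous => //; last by move=> st; exact: cvg_snd.
    apply: clamp_comp_continuous; apply: mul_real_continuous => //.
    exact: cst_real_continuous.
  + apply: comp_pair_continuous => //; last by move=> st; exact: cvg_snd.
    apply: clamp_comp_continuous; apply: sub_real_continuous.
      by apply: mul_real_continuous => //; exact: cst_real_continuous.
    exact: cst_real_continuous.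
  + by move=> s ->; rewrite divff ?pnatr_eq0// subrr Hy Gx.
- by rewrite /path_concat; case: ifP.
- by rewrite /path_concat; case: ifP.
- by rewrite ival0 invr_ge0 ler0n mulr0 Hx.
- rewrite ival1 ifF; last by apply/negP; lra.
  by rewrite (_ : 2 * 1 - 1 = 1) ?Gy//; lra.
Qed.

Lemma path_inverse_homotopic x y (p p' : {path I from x to y in T}) :
  path_homotopic p p' ->
  path_homotopic (path_inverse p) (path_inverse p').
Proof.
move=> [H [Hc H0 H1 Hx Hy]].
exists (fun st => H (clamp (1 - ival st.1), st.2)); split=> [|s|s|t|t] /=.
- apply: comp_pair_continuous => //; last by move=> st; exact: cvg_snd.
  apply: clamp_comp_continuous; apply: sub_real_continuous.
    exact: cst_real_continuous.
  by apply: ival_comp_continuous => ?; exact: cvg_fst.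
- by rewrite H0.
- by rewrite H1.
- by rewrite ival0 subr0 Hy.
- by rewrite ival1 subrr Hx.
Qed.

Lemma path_concatA x y z w (p : {path I from x to y in T})
    (q : {path I from y to z in T}) (r : {path I from z to w in T}) :
  path_homotopic (path_concat p (path_concat q r))
                 (path_concat (path_concat p q) r).
Proof.
apply: (@path_homotopic_reparam _ _ _ _ (path_concat p (path_concat q r))
  (@ival R)
  (fun i => Num.min (2 * ival i) (Num.min (ival i + 4^-1) (2^-1 * (ival i + 1))))).
- exact: cts_fun.
- exact: ival_continuous.
- do 2?[apply: min_real_continuous]; do ?[apply: mul_real_continuous
    |apply: add_real_continuous|exact: cst_real_continuous
    |exact: ival_continuous].
- by rewrite ival0 minEle ifT ?mulr0// le_min; apply/andP; split; lra.
- rewrite ival1 [X in Num.min _ X]minEle ifF; last by apply/negP; lra.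
  by rewrite minEle ifF; [lra | apply/negP; lra].
- by move=> i; rewrite ivalK.
- move=> i; have [u [u0 u1 ->]] := clamp_ex i; rewrite /=.
  rewrite (clampK (t := u)) ?u0//.
  have [u2|u2] := leP u 2^-1.
    rewrite (path_concatL _ _ (v := u)) /=; last by rewrite u0.
    rewrite [X in Num.min _ X]minEle ifT; last by lra.
    have [u3|u3] := leP u 4^-1.
      rewrite minEle ifT; last by lra.
      rewrite path_concatL /=; last by apply/andP; split; lra.
      by rewrite path_concatL//; apply/andP; split; lra.
    rewrite minEle ifF; last by apply/negP; lra.
    rewrite path_concatR /=; last by apply/andP; split; lra.
    rewrite path_concatR /=; last by apply/andP; split; lra.
    rewrite path_concatL /=; last by apply/andP; split; lra.
    by congr (q (clamp _)); lra.
  rewrite (path_concatR _ _ (v := u)) /=; last by apply/andP; split; lra.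
  rewrite [X in Num.min _ X]minEle ifF; last by apply/negP; lra.
  rewrite minEle ifF; last by apply/negP; lra.
  rewrite path_concatR /=; last by apply/andP; split; lra.
  rewrite path_concatR /=; last by apply/andP; split; lra.
  by congr (r (clamp _)); lra.
Qed.

Lemma path_concat1p x y (p : {path I from x to y in T}) :
  path_homotopic (path_concat (cst x : {path I from x to x in T}) p) p.
Proof.
apply: (@path_homotopic_reparam _ _ _ _ p
  (fun i => Num.max 0 (2 * ival i - 1)) (@ival R)).
- exact: cts_fun.
- apply: max_real_continuous; first exact: cst_real_continuous.
  do ?[apply: mul_real_continuous|apply: sub_real_continuous
    |exact: cst_real_continuous|exact: ival_continuous].
- exact: ival_continuous.
- by rewrite ival0 maxEle ifF//; apply/negP; lra.
- by rewrite ival1 maxEle ifT; lra.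
- move=> i; have [u [u0 u1 ->]] := clamp_ex i; rewrite /=.
  rewrite (clampK (t := u)) ?u0//.
  have [u2|/ltW u2] := leP u 2^-1.
    rewrite path_concatL ?u0// (max_idPl _) ?path0//; lra.
  by rewrite path_concatR ?u2// (max_idPr _)//; lra.
- by move=> i; rewrite ivalK.
Qed.

Lemma path_concatp1 x y (p : {path I from x to y in T}) :
  path_homotopic (path_concat p (cst y : {path I from y to y in T})) p.
Proof.
apply: (@path_homotopic_reparam _ _ _ _ p
  (fun i => Num.min 1 (2 * ival i)) (@ival R)).
- exact: cts_fun.
- apply: min_real_continuous; first exact: cst_real_continuous.
  do ?[apply: mul_real_continuous
    |exact: cst_real_continuous|exact: ival_continuous].
- exact: ival_continuous.
- by rewrite ival0 minEle ifF ?mulr0//; apply/negP; lra.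
- by rewrite ival1 minEle ifT; lra.
- move=> i; have [u [u0 u1 ->]] := clamp_ex i; rewrite /=.
  rewrite (clampK (t := u)) ?u0//.
  have [u2|/ltW u2] := leP u 2^-1.
    by rewrite path_concatL ?u0// (min_idPr _)//; lra.
  by rewrite path_concatR ?u2// (min_idPl _) ?path1//; lra.
- by move=> i; rewrite ivalK.
Qed.

Lemma path_concatpV x y (p : {path I from x to y in T}) :
  path_homotopic (path_concat p (path_inverse p))
                 (cst x : {path I from x to x in T}).
Proof.
apply: (@path_homotopic_reparam _ _ _ _ p
  (fun i => Num.min (2 * ival i) (2 - 2 * ival i)) (fun=> 0)).
- exact: cts_fun.
- apply: min_real_continuous;
  do ?[apply: mul_real_continuous|apply: sub_real_continuous
    |exact: cst_real_continuous|exact: ival_continuous].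
- exact: cst_real_continuous.
- by rewrite ival0 minEle ifT; lra.
- by rewrite ival1 minEle ifF; [|apply/negP]; lra.
- move=> i; have [u [u0 u1 ->]] := clamp_ex i; rewrite /=.
  rewrite (clampK (t := u)) ?u0//.
  have [u2|/ltW u2] := leP u 2^-1.
    by rewrite path_concatL ?u0// (min_idPl _)//; lra.
  rewrite path_concatR ?u2// (min_idPr _); last by lra.
  rewrite /= /path_inverse clampK; last by apply/andP; split; lra.
  by congr (p (clamp _)); lra.
- by move=> i; rewrite path0.
Qed.

Lemma path_concatVp x y (p : {path I from x to y in T}) :
  path_homotopic (path_concat (path_inverse p) p)
                 (cst y : {path I from y to y in T}).
Proof.
apply: (@path_homotopic_reparam _ _ _ _ p
  (fun i => Num.max (1 - 2 * ival i) (2 * ival i - 1)) (fun=> 1)).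
- exact: cts_fun.
- apply: max_real_continuous;
  do ?[apply: mul_real_continuous|apply: sub_real_continuous
    |exact: cst_real_continuous|exact: ival_continuous].
- exact: cst_real_continuous.
- by rewrite ival0 maxEle ifF; [|apply/negP]; lra.
- by rewrite ival1 maxEle ifT; lra.
- move=> i; have [u [u0 u1 ->]] := clamp_ex i; rewrite /=.
  rewrite (clampK (t := u)) ?u0//.
  have [u2|/ltW u2] := leP u 2^-1.
    rewrite path_concatL ?u0// (max_idPl _); last by lra.
    by rewrite /= /path_inverse clampK//; apply/andP; split; lra.
  by rewrite path_concatR ?u2// (max_idPr _)//; lra.
- by move=> i; rewrite path1.
Qed.

End path_operations.

Section fundamental_group.
Context (R : realType) (T : topologicalType) (x : T).
Local Notation loop := {path (unit_interval R) from x to x in T}.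

Let loop_homotopic (p q : loop) : bool := `[< path_homotopic p q >].

Fact loop_homotopic_refl : reflexive loop_homotopic.
Proof. by move=> p; apply/asboolP/path_homotopic_refl. Qed.

Fact loop_homotopic_sym : symmetric loop_homotopic.
Proof. by move=> p q; apply/asboolP/asboolP => /path_homotopic_sym. Qed.

Fact loop_homotopic_trans : transitive loop_homotopic.
Proof.
move=> q p r /asboolP pq /asboolP qr.
by apply/asboolP/(path_homotopic_trans pq qr).
Qed.

Definition loop_equiv : equiv_rel loop := EquivRel loop_homotopic
  loop_homotopic_refl loop_homotopic_sym loop_homotopic_trans.

Definition pi1 : Type := {eq_quot loop_equiv}.

HB.instance Definition _ := Choice.copy pi1 {eq_quot loop_equiv}.

Definition loop_class (p : loop) : pi1 := \pi_({eq_quot loop_equiv}) p.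

Definition loop_repr (u : pi1) : loop := repr (u : {eq_quot loop_equiv}).

Lemma loop_reprK u : loop_class (loop_repr u) = u.
Proof. exact: reprK. Qed.

Lemma loop_classP p q : loop_class p = loop_class q <-> path_homotopic p q.
Proof.
split=> [/eqmodP/asboolP//|pq].
by apply/eqmodP/asboolP.
Qed.

Lemma loop_repr_class p : path_homotopic (loop_repr (loop_class p)) p.
Proof. by apply/loop_classP; rewrite loop_reprK. Qed.

Definition pi1_one : pi1 := loop_class (cst x).
Definition pi1_mul (u v : pi1) : pi1 :=
  loop_class (path_concat (loop_repr u) (loop_repr v)).
Definition pi1_inv (u : pi1) : pi1 := loop_class (path_inverse (loop_repr u)).

Lemma pi1_mulE p q :
  pi1_mul (loop_class p) (loop_class q) = loop_class (path_concat p q).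
Proof.
by apply/loop_classP/path_concat_homotopic; exact: loop_repr_class.
Qed.

Lemma pi1_invE p : pi1_inv (loop_class p) = loop_class (path_inverse p).
Proof. by apply/loop_classP/path_inverse_homotopic/loop_repr_class. Qed.

Lemma pi1_ind (P : pi1 -> Prop) : (forall p, P (loop_class p)) -> forall u, P u.
Proof. by move=> h u; rewrite -(loop_reprK u). Qed.

Fact pi1_mulA : associative pi1_mul.
Proof.
elim/pi1_ind => p; elim/pi1_ind => q; elim/pi1_ind => r.
by rewrite !pi1_mulE; apply/loop_classP/path_concatA.
Qed.

Fact pi1_mul1 : left_id pi1_one pi1_mul.
Proof.
by elim/pi1_ind => p; rewrite pi1_mulE; apply/loop_classP/path_concat1p.
Qed.

Fact pi1_1mul : right_id pi1_one pi1_mul.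
Proof.
by elim/pi1_ind => p; rewrite pi1_mulE; apply/loop_classP/path_concatp1.
Qed.

Fact pi1_mulV : left_inverse pi1_one pi1_inv pi1_mul.
Proof.
elim/pi1_ind => p.
by rewrite pi1_invE pi1_mulE; apply/loop_classP/path_concatVp.
Qed.

Fact pi1_Vmul : right_inverse pi1_one pi1_inv pi1_mul.
Proof.
elim/pi1_ind => p.
by rewrite pi1_invE pi1_mulE; apply/loop_classP/path_concatpV.
Qed.

HB.instance Definition _ :=
  isGroup.Build pi1 pi1_mulA pi1_mul1 pi1_1mul pi1_mulV pi1_Vmul.

End fundamental_group.

Section induced_map.
Context (R : realType) (T U : topologicalType).
Variables (f : continuousType T U) (x : T).

Definition pi1_map (u : pi1 R x) : pi1 R (f x) :=
  loop_class (f \o loop_repr u).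

Lemma pi1_mapE p : pi1_map (loop_class p) = loop_class (f \o p).
Proof.
apply/loop_classP.
have [H [Hc H0 H1 Hx Hy]] := loop_repr_class p.
exists (fun st => f (H st)); split=> [|s|s|t|t] /=.
- by apply: comp_continuous => //; exact: cts_fun.
- by rewrite H0.
- by rewrite H1.
- by rewrite Hx.
- by rewrite Hy.
Qed.

Fact pi1_map_mul : {morph pi1_map : u v / (u * v)%g}.
Proof.
elim/pi1_ind => p; elim/pi1_ind => q.
rewrite [(_ * _)%g]pi1_mulE !pi1_mapE [RHS]pi1_mulE; congr loop_class.
by apply/path_eqP => t /=; rewrite /path_concat; case: ifP.
Qed.

HB.instance Definition _ :=
  isMultiplicative.Build (pi1 R x) (pi1 R (f x)) pi1_map pi1_map_mul.

End induced_map.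

Arguments pi1_map R {T U} f x u.

Definition group_isomorphic (G H : groupType) : Prop :=
  exists f : {multiplicative G -> H}, bijective f.

Definition subspace_incl (T : topologicalType) (A : set T) :
    continuousType (set_type A) T :=
  mkcts (initial_continuous (f := set_val) : continuous (set_val : A -> T)).

Definition path_connected (R : realType) (T : topologicalType) : Prop :=
  forall x y : T, inhabited {path (unit_interval R) from x to y in T}.

Definition discrete_subspace (T : topologicalType) (A : set T) : Prop :=
  A `<=` isolated A.

Section cw_complex.
Context (R : realType).

Definition disc n : set 'rV[R]_n := [set v | \sum_i v 0 i ^+ 2 <= 1].
Definition open_disc n : set 'rV[R]_n := [set v | \sum_i v 0 i ^+ 2 < 1].
Definition sphere n : set 'rV[R]_n := [set v | \sum_i v 0 i ^+ 2 = 1].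

(* Cells with their characteristic maps, defined on the closed discs: the values
   of a characteristic map outside the disc are irrelevant. *)
Record cell_family (T : topologicalType) : Type := CellFamily {
  cell : Type;
  cell_dim : cell -> nat;
  cell_map : forall c : cell, 'rV[R]_(cell_dim c) -> T
}.

Section cells.
Context (T : topologicalType) (X : cell_family T).

Definition open_cell (c : cell X) : set T :=
  cell_map (c := c) @` @open_disc (cell_dim c).

Definition closed_cell (c : cell X) : set T :=
  cell_map (c := c) @` @disc (cell_dim c).

End cells.

Record cw_structure (T : topologicalType) : Type := CWStructure {
  cw_cells :> cell_family T;
  cw_hausdorff : hausdorff_space T;
  cw_map_continuous : forall c : cell cw_cells,
    {within @disc (cell_dim c), continuous (cell_map (c := c))};
  (* the next two fields: the characteristic map restricts to a homeomorphism
     from the open disc onto the open cell *)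
  cw_map_inj : forall c : cell cw_cells,
    {in @open_disc (cell_dim c) &, injective (cell_map (c := c))};
  cw_map_open : forall (c : cell cw_cells) (U : set 'rV[R]_(cell_dim c)),
    open U -> exists2 V : set T, open V &
      cell_map (c := c) @` (U `&` @open_disc (cell_dim c)) = V `&` open_cell c;
  cw_cover : forall x, exists c : cell cw_cells, open_cell c x;
  cw_disjoint : forall (c d : cell cw_cells) x,
    open_cell c x -> open_cell d x -> c = d;
  cw_closure_finite : forall c : cell cw_cells,
    exists F : set (cell cw_cells), [/\ finite_set F,
      forall d, F d -> (cell_dim d < cell_dim c)%N &
      cell_map (c := c) @` @sphere (cell_dim c) `<=`
        \bigcup_(d in F) open_cell d];
  cw_weak : forall C : set T,
    (forall c : cell cw_cells, closed (C `&` closed_cell c)) -> closed C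
}.

Definition subcomplex (T : topologicalType) (X : cw_structure T) (S : set T) :
    Prop :=
  exists2 E : set (cell X), S = \bigcup_(c in E) open_cell c &
    forall c, E c -> closed_cell c `<=` S.

End cw_complex.

Record simplicial_complex (n : nat) : Type := SimplicialComplex {
  faces :> {set {set 'I_n}};
  face0 : finset.set0 \in faces;
  face1 : forall i, finset.set1 i \in faces;
  face_sub : forall s t : {set 'I_n}, s \in faces -> t \subset s -> t \in faces
}.

Section polyhedral_product.
Context (n : nat) (K : simplicial_complex n) (T : topologicalType).
Implicit Types X A : set T.
Local Notation Tn := (prod_topology (fun _ : 'I_n => T)).

(* X and A are subspaces of an ambient space T, so that the polyhedral product
   is a subset of X ^ n, itself a subset of T ^ n. *)
Definition polyhedral_block X A (s : {set 'I_n}) : set Tn :=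
  [set y | forall i, (if i \in s then X else A) (y i)].

Definition polyhedral_product X A : set Tn :=
  \bigcup_(s in [set` faces K]) polyhedral_block X A s.

Fact polyhedral_base_subproof X A (a : T) : A a ->
  (fun=> a) \in polyhedral_product X A.
Proof.
move=> Aa; apply/mem_set; exists finset.set0; first exact: face0.
by move=> i; rewrite inE.
Qed.

Definition polyhedral_base X A (a : T) (Aa : A a) :
    set_type (polyhedral_product X A) :=
  exist _ (fun=> a) (polyhedral_base_subproof X Aa).

End polyhedral_product.

(* Main.v *)
Require Import Defs.
From mathcomp Require Import all_boot all_order all_algebra.
From mathcomp Require Import all_classical all_reals all_analysis homotopy.
From mathcomp Require Import lra.
Set Implicit Arguments.
Unset Strict Implicit.
Unset Printing Implicit Defensive.
Import Order.TTheory GRing.Theory Num.Theory.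
Import numFieldNormedType.Exports.
Local Open Scope classical_set_scope.
Local Open Scope ring_scope.

(** Write Z(B) for the polyhedral product of the pair (B, A): the points of B^n
whose coordinates outside some face of K lie in A.  The inclusion of Z(X) in
Z(Y) is bijective on fundamental groups because loops and homotopies in Z(Y)
can be pushed into Z(X) coordinate by coordinate, provided that on each small
piece of the parameter space only the coordinates in one face of K are moved,
while all others stay in A throughout the piece: then no face condition is
ever violated.

A coordinate can enter and leave A infinitely often, so such pieces need not
exist at first.  This is cured by a deformation h of Y that fixes A, preserves
X, and ends by mapping a whole neighbourhood of A into A
([subcomplex_retraction]).  On every cell outside A it expands the disc
radially; a point that reaches the boundary of its cell goes on in the cells
of lower dimension.  After composition with the end of h, each parameter has a
neighbourhood on which all coordinates outside one face of K are in A, so that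
by compactness the parameter square can be cut into dyadic squares, each of
which has this property ([small_square_ex]).

It remains to replace, for one coordinate, a map q from a small square to Y by
a map to X.  First its edges are replaced: each path p in Y is swept, by a
homotopy whose ends follow paths that depend only on the end points of p, to a
path in X ([straighten_path]); this uses that the map of fundamental groups is
surjective.  The boundary of q so becomes a boundary in X which is still filled
in Y, hence also in X, since the map of fundamental groups is injective
([square_refill]).  Three features make the pieces fit.  The new edges depend on
the old edges alone, so that the replacements of adjacent squares agree and can
be glued; what lies in X already, in particular in A, is not changed; and
therefore the glued map of all coordinates is in Z(X).  Applied to a loop of
Z(Y), the sweeps give surjectivity ([polyhedral_pi1_surj]); applied to a
homotopy in Z(Y) between loops of Z(X), the refilled squares give injectivity
([polyhedral_pi1_inj]). *)

(** * Gluing and continuity *)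

(** Only closedness of the pieces is used, so each local map may be any
formula that is continuous everywhere but meaningful on its own piece only. *)
Lemma closed_glue (J : finType) (S T : topologicalType) (D : J -> set S)
    (g : J -> S -> T) :
  (forall j, closed (D j)) -> (forall j, continuous (g j)) ->
  (forall s, exists j, D j s) ->
  (forall i j s, D i s -> D j s -> g i s = g j s) ->
  exists f : S -> T, continuous f /\ forall j s, D j s -> f s = g j s.
Proof.
move=> Dcl gc cov agr.
pose f s := g (projT1 (cid (cov s))) s.
have fE j s : D j s -> f s = g j s.
  by move=> Djs; apply: agr => //; exact: (projT2 (cid (cov s))).
exists f; split=> //; apply/continuous_closedP => C clC.
rewrite (_ : f @^-1` C = \bigcup_(j in [set: J]) (D j `&` g j @^-1` C)).
  apply: closed_bigcup; first exact: finite_finset.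
  move=> j _; apply: closedI => //; move: (gc j) => /continuous_closedP; exact.
apply/seteqP; split=> s /=.
  by move=> Cs; have [j Djs] := cov s; exists j => //; split; rewrite /= -?fE.
by move=> [j _ [Djs Cs]]; rewrite (fE j).
Qed.

Lemma continuous_preimage_closed (S T : topologicalType) (f : S -> T) (C : set T) :
  continuous f -> closed C -> closed (f @^-1` C).
Proof. by move/continuous_closedP; apply. Qed.

Lemma closed_le_fun (R : realType) (S : topologicalType) (f g : S -> R) :
  continuous f -> continuous g -> closed [set s | f s <= g s].
Proof.
move=> fc gc; rewrite (_ : [set _ | _] = (fun s => f s - g s) @^-1` [set r | r <= 0]).
  apply: continuous_preimage_closed; first exact: sub_real_continuous.
  exact: closed_le.
by apply/seteqP; split=> s /=; rewrite subr_le0.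
Qed.

Lemma inv_real_continuous (R : realType) (S : topologicalType) (f : S -> R) :
  continuous f -> (forall s, f s != 0) -> continuous (fun s => (f s)^-1).
Proof. by move=> fc f0 s; apply: cvgV; [exact: f0 | exact: fc]. Qed.

Lemma opp_real_continuous (R : realType) (S : topologicalType) (f : S -> R) :
  continuous f -> continuous (fun s => - f s).
Proof. by move=> fc s; apply: cvgN; exact: fc. Qed.

Lemma pair_continuous (S A B : topologicalType) (f : S -> A) (g : S -> B) :
  continuous f -> continuous g -> continuous (fun s => (f s, g s)).
Proof.
move=> fc gc; apply: (comp_pair_continuous (H := fun p => p)) => // p.
exact: cvg_id.
Qed.

Lemma fst_comp_continuous (S A B : topologicalType) (f : S -> A * B) :
  continuous f -> continuous (fun s => (f s).1).
Proof. by move=> fc; apply: comp_continuous => // ?; exact: cvg_fst. Qed.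

Lemma snd_comp_continuous (S A B : topologicalType) (f : S -> A * B) :
  continuous f -> continuous (fun s => (f s).2).
Proof. by move=> fc; apply: comp_continuous => // ?; exact: cvg_snd. Qed.

Lemma id_continuous (S : topologicalType) : continuous (fun s : S => s).
Proof. by move=> s; exact: cvg_id. Qed.

Lemma const_continuous (S T : topologicalType) (a : T) :
  continuous (fun _ : S => a).
Proof. by move=> s; exact: cvg_cst. Qed.

(** Structural proof of continuity for the explicit formulas in the interval
coordinates; the side conditions on denominators are left open. *)
Ltac cont := lazymatch goal with
  | |- continuous (fun s => @clamp _ (@?f s)) =>
      refine (@clamp_comp_continuous _ _ f _); cont
  | |- continuous (fun s => @ival _ (@?f s)) =>
      refine (@ival_comp_continuous _ _ f _); cont
  | |- continuous (fun s => (- @?f s)%R) =>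
      refine (@opp_real_continuous _ _ f _); cont
  | |- continuous (fun s => (@?f s + @?g s)%R) =>
      refine (@add_real_continuous _ _ f g _ _); cont
  | |- continuous (fun s => (@?f s * @?g s)%R) =>
      refine (@mul_real_continuous _ _ f g _ _); cont
  | |- continuous (fun s => Num.max (@?f s) (@?g s)) =>
      refine (@max_real_continuous _ _ f g _ _); cont
  | |- continuous (fun s => Num.min (@?f s) (@?g s)) =>
      refine (@min_real_continuous _ _ f g _ _); cont
  | |- continuous (fun s => ((@?f s)^-1)%R) =>
      first [exact: const_continuous
            | refine (@inv_real_continuous _ _ f _ _); [cont | ]]
  | |- continuous (fun s => (@?f s, @?g s)) =>
      refine (@pair_continuous _ _ _ f g _ _); cont
  | |- continuous (pair ?a) =>
      refine (@pair_continuous _ _ _ (fun=> a) (fun s => s) _ _); cont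
  | |- continuous (@fst _ _) => refine (@fst_comp_continuous _ _ _ (fun s => s) _); cont
  | |- continuous (@snd _ _) => refine (@snd_comp_continuous _ _ _ (fun s => s) _); cont
  | |- continuous (fun s => fst (@?f s)) =>
      refine (@fst_comp_continuous _ _ _ f _); cont
  | |- continuous (fun s => snd (@?f s)) =>
      refine (@snd_comp_continuous _ _ _ f _); cont
  | |- continuous (fun s => s) => exact: id_continuous
  | |- _ => first [exact: const_continuous | assumption | lazymatch goal with
    | |- continuous (fun s => ?h (@?f s)) =>
      refine (@comp_continuous _ _ _ h f _ _); [try assumption | cont]
    end]
  end.

(** * Filling open boxes *)

Section squares.
Context {R : realType}.
Local Notation I := (unit_interval R).

Lemma zeroE : zero = clamp 0 :> I. Proof. by []. Qed.
Lemma oneE : one = clamp 1 :> I. Proof. by []. Qed.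

Definition maps_in (S T : topologicalType) (B : set T) (f : S -> T) :=
  continuous f /\ forall s, B (f s).

Lemma maps_in_comp (S S' T : topologicalType) (B : set T) (f : S -> T)
    (g : S' -> S) :
  maps_in B f -> continuous g -> maps_in B (fun s => f (g s)).
Proof. by move=> [fc fB] gc; split=> //; cont. Qed.

(** The order of the edges is bottom, top, left, right.  Horizontal edges run
to the right and vertical edges run upwards, and a homotopy relative to end
points is a square whose left and right edges are constant. *)
Definition square_in (T : topologicalType) (B : set T) (b t l r : I -> T) :=
  exists2 Q : I * I -> T, maps_in B Q &
    [/\ forall u, Q (u, zero) = b u, forall u, Q (u, one) = t u,
        forall u, Q (zero, u) = l u & forall u, Q (one, u) = r u].

(** The position of x in the segment [- m, m], rescaled to the unit interval.
*)
Definition scaled (x m : R) : I := clamp ((x * m^-1 + 1) / 2).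

Lemma scaledN x m : m != 0 -> x = - m -> scaled x m = zero.
Proof. by move=> m0 ->; rewrite zeroE /scaled mulNr divff// addNr mul0r. Qed.
Lemma scaledp x m : m != 0 -> x = m -> scaled x m = one.
Proof. by move=> m0 ->; rewrite oneE /scaled divff//; congr clamp; lra. Qed.
Lemma scaled_half x : scaled x 2^-1 = clamp (x + 2^-1).
Proof. by rewrite /scaled invrK; congr clamp; lra. Qed.
Lemma scaled1 x : scaled x 1 = clamp ((x + 1) / 2).
Proof. by rewrite /scaled invr1 mulr1. Qed.

(** Around the central square of [-1, 1]^2 (index None) lie four trapezoids:
bottom, top, left and right for (true, true), (true, false), (false, true) and
(false, false). *)
Definition region (j : option (bool * bool)) (x y : R) : Prop := match j with
  | None => [/\ - 2^-1 <= x, x <= 2^-1, - 2^-1 <= y & y <= 2^-1]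
  | Some (true, true) => [/\ 2^-1 <= - y, y <= x & x <= - y]
  | Some (true, false) => [/\ 2^-1 <= y, - y <= x & x <= y]
  | Some (false, true) => [/\ 2^-1 <= - x, x <= y & y <= - x]
  | Some (false, false) => [/\ 2^-1 <= x, - x <= y & y <= x]
  end.

Lemma region_cover x y : exists j, region j x y.
Proof.
have [xy|/ltW xy] := leP x y; have [xy'|/ltW xy'] := leP x (- y).
- have [h|/ltW h] := leP 2^-1 (- x); first by exists (Some (false, true)); split; lra.
  by exists None; split; lra.
- have [h|/ltW h] := leP 2^-1 y; first by exists (Some (true, false)); split; lra.
  by exists None; split; lra.
- have [h|/ltW h] := leP 2^-1 (- y); first by exists (Some (true, true)); split; lra.
  by exists None; split; lra.
- have [h|/ltW h] := leP 2^-1 x; first by exists (Some (false, false)); split; lra.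
  by exists None; split; lra.
Qed.

Lemma region_closed (S : topologicalType) (x y : S -> R) j :
  continuous x -> continuous y -> closed [set s | region j (x s) (y s)].
Proof.
move=> xc yc.
have cl3 (f1 g1 f2 g2 f3 g3 : S -> R) :
    continuous f1 -> continuous g1 -> continuous f2 -> continuous g2 ->
    continuous f3 -> continuous g3 ->
    closed [set s | [/\ f1 s <= g1 s, f2 s <= g2 s & f3 s <= g3 s]].
  move=> c1 d1 c2 d2 c3 d3; rewrite (_ : [set _ | _] = [set s | f1 s <= g1 s]
    `&` [set s | f2 s <= g2 s] `&` [set s | f3 s <= g3 s]).
    by do ?[apply: closedI]; exact: closed_le_fun.
  by apply/seteqP; split=> s [] // [].
case: j => [[[] []]|]; rewrite /region; try by apply: cl3; cont.
rewrite (_ : [set _ | _] = [set s | [/\ - 2^-1 <= x s, x s <= 2^-1 & - 2^-1 <= y s]]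
    `&` [set s | y s <= 2^-1]).
  apply: closedI; [apply: cl3 | apply: closed_le_fun]; cont.
by apply/seteqP; split=> s; [move=> [] | move=> [[]]].
Qed.

Let cx (z : I * I) := 2 * ival z.1 - 1.
Let cy (z : I * I) := 2 * ival z.2 - 1.

(** Five faces of a cube, the bottom q and the four sides, can be flattened
onto a square: q fills the half-size square in the centre, and each side fills
the trapezoid between an edge of the central square and the corresponding edge
of the large one.  The outer boundary of the result consists of the top edges
of the sides. *)
Lemma open_box_filling (T : topologicalType) (B : set T) (q Sb St Sl Sr : I * I -> T) :
  maps_in B q -> maps_in B Sb -> maps_in B St -> maps_in B Sl -> maps_in B Sr ->
  (forall u, Sb (u, zero) = q (u, zero)) -> (forall u, St (u, zero) = q (u, one)) ->
  (forall u, Sl (u, zero) = q (zero, u)) -> (forall u, Sr (u, zero) = q (one, u)) ->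
  (forall e, Sb (zero, e) = Sl (zero, e)) -> (forall e, Sb (one, e) = Sr (zero, e)) ->
  (forall e, St (zero, e) = Sl (one, e)) -> (forall e, St (one, e) = Sr (one, e)) ->
  square_in B (fun u => Sb (u, one)) (fun u => St (u, one))
              (fun u => Sl (u, one)) (fun u => Sr (u, one)).
Proof.
move=> [qc qB] [bc bB] [tc tB] [lc lB] [rc rB] qb qt ql qr bl br tl tr.
pose D (j : option (bool * bool)) : set (I * I) := [set z | region j (cx z) (cy z)].
(* outside the central square the larger coordinate is at least 1/2, so the
bound only serves to divide by it continuously *)
pose half (x : R) := Num.max x 2^-1.
pose side (Q : I * I -> T) (x m : R) := Q (scaled x (half m), clamp (2 * half m - 1)).
pose g (j : option (bool * bool)) z := match j with
  | None => q (clamp (cx z + 2^-1), clamp (cy z + 2^-1))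
  | Some (true, true) => side Sb (cx z) (- cy z)
  | Some (true, false) => side St (cx z) (cy z)
  | Some (false, true) => side Sl (cy z) (- cx z)
  | Some (false, false) => side Sr (cy z) (cx z)
  end.
have half0 x : half x != 0 by rewrite /half; case: leP; lra.
have halfE x : 2^-1 <= x -> half x = x by move=> ?; exact/max_idPl.
have cxc : continuous cx by rewrite /cx; cont.
have cyc : continuous cy by rewrite /cy; cont.
have sidec Q x m : continuous Q -> continuous x -> continuous m ->
    continuous (fun z : I * I => side Q (x z) (m z)).
  by move=> Qc xc mc; rewrite /side /scaled /half; cont => // z; exact: half0.
have side_mid Q x m : m = 2^-1 -> side Q x m = Q (clamp (x + 2^-1), zero).
  by move=> ->; rewrite /side halfE// scaled_half divff// subrr.
have sideN Q x m : 2^-1 <= m -> x = - m -> side Q x m = Q (zero, clamp (2 * m - 1)).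
  by move=> mh xm; rewrite /side halfE// scaledN//; lra.
have sidep Q x m : 2^-1 <= m -> x = m -> side Q x m = Q (one, clamp (2 * m - 1)).
  by move=> mh xm; rewrite /side halfE// scaledp//; lra.
have side1 Q u x m : x = 2 * ival u - 1 -> m = 1 -> side Q x m = Q (u, one).
  move=> -> ->; rewrite /side halfE; last lra.
  by rewrite scaled1 subrK mulrAC divff// mul1r ivalK oneE; congr (Q (_, clamp _)); lra.
have e0 z : cy z = - 2^-1 -> q (clamp (cx z + 2^-1), clamp (cy z + 2^-1)) = q (clamp (cx z + 2^-1), zero).
  by move=> e; rewrite e addNr.
have e1 z : cy z = 2^-1 -> q (clamp (cx z + 2^-1), clamp (cy z + 2^-1)) = q (clamp (cx z + 2^-1), one).
  by move=> e; rewrite e oneE; congr (q (_, clamp _)); lra.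
have e2 z : cx z = - 2^-1 -> q (clamp (cx z + 2^-1), clamp (cy z + 2^-1)) = q (zero, clamp (cy z + 2^-1)).
  by move=> e; rewrite e addNr.
have e3 z : cx z = 2^-1 -> q (clamp (cx z + 2^-1), clamp (cy z + 2^-1)) = q (one, clamp (cy z + 2^-1)).
  by move=> e; rewrite e oneE; congr (q (clamp _, _)); lra.
have cov z : exists j, D j z by exact: region_cover.
have [W [Wc WE]] : exists f, continuous f /\ forall j s, D j s -> f s = g j s.
  apply: closed_glue.
  - by move=> j; exact: region_closed.
  - move=> [[[] []]|]; rewrite /g; try (apply: sidec => //; cont).
    by apply: comp_continuous => //; cont.
  - exact: cov.
  - have sym (P : option (bool * bool) -> option (bool * bool) -> Prop) :
      (forall i j, P i j -> P j i) -> (forall i, P i i) ->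
      (forall i, P None (Some i)) -> (forall i j, P (Some (true, i)) (Some (false, j))) ->
      P (Some (true, true)) (Some (true, false)) ->
      P (Some (false, true)) (Some (false, false)) -> forall i j, P i j.
      move=> Ps Pr PN P1 P2 P3 [[[] []]|] [[[] []]|];
      by [exact: Pr|exact: PN|exact: P1|apply: Ps; exact: P1|apply: Ps; exact: PN
         |apply: Ps|].
    apply: sym.
    + by move=> i j h s Di Dj; rewrite h.
    + by [].
    + move=> [[] []] z [? ? ? ?] [? ? ?] /=.
      * by rewrite e0 ?side_mid ?qb//; lra.
      * by rewrite e1 ?side_mid ?qt//; lra.
      * by rewrite e2 ?side_mid ?ql//; lra.
      * by rewrite e3 ?side_mid ?qr//; lra.
    + move=> [] [] z [? ? ?] [? ? ?] /=.
      * by rewrite !sideN ?bl; [congr (Sl (_, clamp _))|..]; lra.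
      * by rewrite sidep ?sideN ?br; [congr (Sr (_, clamp _))|..]; lra.
      * by rewrite sideN ?sidep ?tl; [congr (Sl (_, clamp _))|..]; lra.
      * by rewrite !sidep ?tr; [congr (Sr (_, clamp _))|..]; lra.
    + by move=> z [? ? ?] [? ? ?]; exfalso; lra.
    + by move=> z [? ? ?] [? ? ?]; exfalso; lra.
exists W; first split=> // z.
  by have [j /WE ->] := cov z; case: j => [[[] []]|];
    [exact: bB|exact: tB|exact: lB|exact: rB|exact: qB].
split=> u; have := ival_ge0 u; have := ival_le1 u => u1 u0.
- rewrite (WE (Some (true, true))) /=; last first.
    by rewrite /cx /cy /= ival0; split; lra.
  by apply: side1; rewrite /cx /cy /= ?ival0; lra.
- rewrite (WE (Some (true, false))) /=; last first.
    by rewrite /cx /cy /= ival1; split; lra.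
  by apply: side1; rewrite /cx /cy /= ?ival1; lra.
- rewrite (WE (Some (false, true))) /=; last first.
    by rewrite /cx /cy /= ival0; split; lra.
  by apply: side1; rewrite /cx /cy /= ?ival0; lra.
- rewrite (WE (Some (false, false))) /=; last first.
    by rewrite /cx /cy /= ival1; split; lra.
  by apply: side1; rewrite /cx /cy /= ?ival1; lra.
Qed.

End squares.

(** * Squares, concatenations and straightening *)

Section square_calculus.
Context {R : realType} {T : topologicalType}.
Local Notation I := (unit_interval R).
Implicit Types (B : set T) (b t l r p c d q : I -> T).

Lemma maps_in_setT (S : topologicalType) (f : S -> T) :
  continuous f -> maps_in setT f.
Proof. by []. Qed.

Lemma square_corners B b t l r : square_in B b t l r ->
  [/\ b zero = l zero, b one = r zero, t zero = l one & t one = r one].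
Proof. by move=> [Q _ [Qb Qt Ql Qr]]; split; rewrite -?Qb -?Qt -?Ql -?Qr. Qed.

Lemma square_edges B b t l r : square_in B b t l r ->
  [/\ maps_in B b, maps_in B t, maps_in B l & maps_in B r].
Proof.
move=> [Q Qm [Qb Qt Ql Qr]].
rewrite -(funext Qb) -(funext Qt) -(funext Ql) -(funext Qr).
by split; apply: (maps_in_comp Qm); cont.
Qed.

Lemma square_setT B b t l r : square_in B b t l r -> square_in setT b t l r.
Proof. by move=> [Q [Qc _] Qe]; exists Q. Qed.

(** The vertical edges over the four corners are named c00, c10, c01 and c11,
with the horizontal coordinate first, so that the matching of adjacent sides
is visible in the hypotheses. *)
Lemma square_of_open_box B b t l r b' t' l' r' c00 c10 c01 c11 :
  square_in B b t l r ->
  square_in B b b' c00 c10 -> square_in B t t' c01 c11 ->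
  square_in B l l' c00 c01 -> square_in B r r' c10 c11 ->
  square_in B b' t' l' r'.
Proof.
move=> [Q Qm [Qb Qt Ql Qr]] [Sb Sbm [bb bt bl br]] [St Stm [tb tt tl tr]].
move=> [Sl Slm [lb lt ll lr]] [Sr Srm [rb rt rl rr]].
have [|||||||| W Wm [Wb Wt Wl Wr]] := open_box_filling Qm Sbm Stm Slm Srm.
- by move=> u; rewrite bb Qb.
- by move=> u; rewrite tb Qt.
- by move=> u; rewrite lb Ql.
- by move=> u; rewrite rb Qr.
- by move=> u; rewrite bl ll.
- by move=> u; rewrite br rl.
- by move=> u; rewrite tl lr.
- by move=> u; rewrite tr rr.
by exists W => //; split=> u; rewrite ?Wb ?Wt ?Wl ?Wr ?bt ?tt ?lt ?rt.
Qed.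

Definition rev p : I -> T := fun u => p (clamp (1 - ival u)).

Lemma rev_zero p : rev p zero = p one.
Proof. by rewrite /rev ival0 subr0 -oneE. Qed.
Lemma rev_one p : rev p one = p zero.
Proof. by rewrite /rev ival1 subrr -zeroE. Qed.
Lemma revK p : rev (rev p) = p.
Proof.
apply/funext => u; rewrite /rev clampK; first by rewrite subKr ivalK.
by rewrite subr_ge0 ival_le1 gerBl ival_ge0.
Qed.
Lemma rev_cst (x : T) : rev (cst x) = cst x.
Proof. by []. Qed.

Lemma maps_in_rev B p : maps_in B p -> maps_in B (rev p).
Proof. by move=> pm; apply: (maps_in_comp pm); cont. Qed.

Lemma square_flip B b t l r : square_in B b t l r ->
  square_in B t b (rev l) (rev r).
Proof.
move=> [Q Qm [Qb Qt Ql Qr]].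
exists (fun z => Q (z.1, clamp (1 - ival z.2))).
  by apply: (maps_in_comp Qm); cont.
split=> u /=.
- by rewrite ival0 subr0 -oneE.
- by rewrite ival1 subrr -zeroE.
- by rewrite Ql.
- by rewrite Qr.
Qed.

Lemma square_triv B p : maps_in B p ->
  square_in B p p (cst (p zero)) (cst (p one)).
Proof.
move=> pm; exists (fun z => p z.1) => //.
by apply: (maps_in_comp pm); cont.
Qed.

(** The left, top and right sides form one path P, parametrized by [-1, 2]; at
height s the square runs along the portion of P between s - 1 and 2 - s. *)
Lemma three_sides_filling B p c d : maps_in B p -> maps_in B c -> maps_in B d ->
  c one = p zero -> d one = p one -> exists b, square_in B b p c d.
Proof.
move=> pm cm dm cp dp.
(* d is traversed backwards *)
pose P (u : R) := if u <= 0 then c (clamp (u + 1)) else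
  if u <= 1 then p (clamp u) else d (clamp (2 - u)).
have P0 u : u <= 0 -> P u = c (clamp (u + 1)) by rewrite /P => ->.
have P1 u : 0 <= u -> u <= 1 -> P u = p (clamp u).
  move=> u0 u1; rewrite /P u1; case: leP => // u0'.
  have -> : u = 0 by lra.
  by rewrite add0r -oneE cp.
have P2 u : 1 <= u -> P u = d (clamp (2 - u)).
  move=> u1; rewrite /P ifF; last by apply/negbTE; rewrite -ltNge; lra.
  have [u1'|//] := leP u 1; have -> : u = 1 by lra.
  rewrite (_ : 2 - 1 = 1 :> R); last lra.
  by rewrite -oneE dp.
have Pm : maps_in B P.
  case: pm => pc pB; case: cm => cc cB; case: dm => dc dB.
  split; last first.
    by move=> u; rewrite /P; case: ifP => // _; case: ifP.
  apply: (@if_le_continuous _ _ _ id 0 (fun u => c (clamp (u + 1)))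
    (fun u => if u <= 1 then p (clamp u) else d (clamp (2 - u)))).
  - exact: id_continuous.
  - cont.
  - apply: (@if_le_continuous _ _ _ id 1 (fun u => p (clamp u))
      (fun u => d (clamp (2 - u)))).
    + exact: id_continuous.
    + cont.
    + cont.
    + move=> s ->; rewrite (_ : 2 - 1 = 1 :> R); last lra.
      by rewrite -oneE dp.
  - by move=> s ->; rewrite ler01 add0r -oneE -zeroE cp.
pose Q (z : I * I) := P (ival z.2 - 1 + ival z.1 * (3 - 2 * ival z.2)).
exists (fun u => Q (u, zero)), Q.
  by apply: (maps_in_comp Pm); cont.
split=> // u; have := ival_ge0 u; have := ival_le1 u => u1 u0; rewrite /Q /=.
- rewrite ival1 P1; [|lra..].
  by rewrite -[in RHS](ivalK u); congr (p (clamp _)); lra.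
- rewrite ival0 P0; last lra.
  by rewrite -[in RHS](ivalK u); congr (c (clamp _)); lra.
- rewrite ival1 P2; last lra.
  by rewrite -[in RHS](ivalK u); congr (d (clamp _)); lra.
Qed.

Definition concat p q : I -> T := fun u =>
  if ival u <= 2^-1 then p (clamp (2 * ival u)) else q (clamp (2 * ival u - 1)).

Section concat.
Variables (p q : I -> T).
Hypothesis pq : p one = q zero.

Lemma concatL (v : R) : 0 <= v -> v <= 2^-1 ->
  concat p q (clamp v) = p (clamp (2 * v)).
Proof.
by move=> v0 v1; rewrite /concat clampK; [rewrite v1|apply/andP; split; lra].
Qed.

Lemma concatR (v : R) : 2^-1 <= v -> v <= 1 ->
  concat p q (clamp v) = q (clamp (2 * v - 1)).
Proof.
move=> v0 v1; rewrite /concat clampK; last by apply/andP; split; lra.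
case: leP => // v2; have -> : v = 2^-1 by lra.
by rewrite divff ?pnatr_eq0// subrr -oneE -zeroE.
Qed.

Lemma concat_zero : concat p q zero = p zero.
Proof. by rewrite zeroE concatL ?mulr0//; lra. Qed.

Lemma concat_one : concat p q one = q one.
Proof. by rewrite oneE concatR ?mulr1; [congr (q (clamp _))|..]; lra. Qed.

Lemma maps_in_concat B : maps_in B p -> maps_in B q -> maps_in B (concat p q).
Proof.
move=> [pc pB] [qc qB]; split; last by move=> u; rewrite /concat; case: ifP.
apply: if_le_continuous; [exact: ival_continuous|cont..|].
by move=> s ->; rewrite divff ?pnatr_eq0// subrr.
Qed.
End concat.

Section square_concat.
Variables (B : set T) (b t l r : I -> T).
Hypotheses (bm : maps_in B b) (tm : maps_in B t) (lm : maps_in B l)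
  (rm : maps_in B r).
Hypotheses (bl : b zero = l zero) (br : b one = r zero) (tl : t zero = l one)
  (tr : t one = r one).

Let sb : square_in B (concat b r) b (cst (b zero)) (rev r).
Proof.
exists (fun z => concat b r (clamp (ival z.1 * (1 - ival z.2 / 2)))).
  apply: (maps_in_comp (maps_in_concat _ _ _)) => //.
  cont.
split=> u; have := ival_ge0 u; have := ival_le1 u => u1 u0 /=.
- by rewrite ival0 mul0r subr0 mulr1 ivalK.
- rewrite ival1 concatL; [|lra..].
  by rewrite -[in RHS](ivalK u); congr (b (clamp _)); lra.
- by rewrite ival0 mul0r -zeroE concat_zero.
- rewrite ival1 mul1r concatR//; [|lra..].
  by congr (r (clamp _)); lra.
Qed.

Let st : square_in B (concat l t) t l (cst (t one)).
Proof.
exists (fun z => concat l t (clamp (ival z.2 / 2 + ival z.1 * (1 - ival z.2 / 2)))).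
  apply: (maps_in_comp (maps_in_concat _ _ _)) => //.
  cont.
split=> u; have := ival_ge0 u; have := ival_le1 u => u1 u0 /=.
- by rewrite ival0 mul0r subr0 mulr1 add0r ivalK.
- rewrite ival1 concatR//; [|lra..].
  by rewrite -[in RHS](ivalK u); congr (t (clamp _)); lra.
- rewrite ival0 concatL//; [|lra..].
  by rewrite -[in RHS](ivalK u); congr (l (clamp _)); lra.
- rewrite ival1 mul1r concatR//; [|lra..].
  by rewrite oneE; congr (t (clamp _)); lra.
Qed.

Let sl : square_in B (cst (b zero)) l (cst (b zero)) l.
Proof.
exists (fun z => l (clamp (ival z.2 * ival z.1))).
  by apply: (maps_in_comp lm); cont.
split=> u /=; rewrite ?ival0 ?ival1 ?mul0r ?mulr0 ?mul1r ?mulr1 ?ivalK//;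
  by rewrite bl zeroE.
Qed.

Let sr : square_in B (cst (t one)) r (rev r) (cst (t one)).
Proof.
exists (fun z => r (clamp (1 - ival z.2 * (1 - ival z.1)))).
  by apply: (maps_in_comp rm); cont.
split=> u /=; rewrite ?ival0 ?ival1 ?subr0 ?subrr ?mul0r ?mulr0 ?mul1r ?mulr1
   ?subr0 ?subKr ?ivalK//; by rewrite tr oneE.
Qed.

(** The two ways around a square are homotopic, and conversely such a homotopy
yields a filling of the square with exactly the given edges: four explicit
squares, each sliding along one of the two concatenations, form an open box
over the homotopy. *)
Lemma square_concatP :
  square_in B (concat b r) (concat l t) (cst (b zero)) (cst (t one)) <->
  square_in B b t l r.
Proof.
split=> Q; first exact: square_of_open_box Q sb st sl sr.
have := square_of_open_box Q (square_flip sb) (square_flip st) (square_flip sl).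
by apply; have := square_flip sr; rewrite rev_cst.
Qed.

End square_concat.
End square_calculus.

Section straightening_system.
Context {R : realType} {Y : topologicalType} (X : set Y).
Local Notation I := (unit_interval R).

(** The ends of a sweep move along paths that depend on the end points of p
alone, so that sweeps of consecutive paths can be glued; and a path in X does
not move, so that neither do the coordinates that are in A throughout. *)
Definition is_sweep (corner : Y -> I -> Y) (sweep : (I -> Y) -> I * I -> Y) :=
  forall p, continuous p ->
  [/\ continuous (sweep p), forall u, X (sweep p (u, one)),
    (forall u, X (p u)) -> sweep p = p \o fst &
    [/\ forall u, sweep p (u, zero) = p u,
      forall v, sweep p (zero, v) = corner (p zero) v &
      forall v, sweep p (one, v) = corner (p one) v]].

(** The edges of the refilled square are the final paths of the sweeps of the
old edges; they depend on these edges only, whence refilled squares with a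
common edge can be glued. *)
Definition is_refill (sweep : (I -> Y) -> I * I -> Y)
    (refill : (I * I -> Y) -> I * I -> Y) :=
  forall q, continuous q ->
  [/\ maps_in X (refill q), (forall z, X (q z)) -> refill q = q &
  [/\ forall u, refill q (u, zero) = sweep (fun v => q (v, zero)) (u, one),
      forall u, refill q (u, one) = sweep (fun v => q (v, one)) (u, one),
      forall u, refill q (zero, u) = sweep (fun v => q (zero, v)) (u, one) &
      forall u, refill q (one, u) = sweep (fun v => q (one, v)) (u, one)]].
End straightening_system.

Section straightening.
Context {R : realType} {Y : topologicalType} (X : set Y) (x0 : Y).
Local Notation I := (unit_interval R).
Implicit Types (p q b t l r c d e : I -> Y).
Hypothesis pathX : forall x, X x ->
  exists2 d : I -> Y, maps_in X d & d zero = x0 /\ d one = x.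
Hypothesis pathY : forall y,
  exists2 d : I -> Y, continuous d & d zero = x0 /\ d one = y.
Hypothesis pi1_surj : forall p, continuous p -> p zero = x0 -> p one = x0 ->
  exists2 q, maps_in X q & square_in setT p q (cst x0) (cst x0).
Hypothesis pi1_inj : forall p q, maps_in X p -> maps_in X q ->
  square_in setT p q (cst x0) (cst x0) -> square_in X p q (cst x0) (cst x0).

(** Joining the corners to the base point turns the edges into loops, for
which fillability says that two loops are homotopic; injectivity of the map of
fundamental groups transfers this from Y to X. *)
Lemma square_refill b t l r : maps_in X b -> maps_in X t -> maps_in X l ->
  maps_in X r -> square_in setT b t l r -> square_in X b t l r.
Proof.
move=> bm tm lm rm Q; have [bl br tl tr] := square_corners Q.
have [d00 d00m [d00x d00y]] := pathX (bm.2 zero).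
have [d10 d10m [d10x d10y]] := pathX (bm.2 one).
have [d01 d01m [d01x d01y]] := pathX (tm.2 zero).
have [d11 d11m [d11x d11y]] := pathX (tm.2 one).
have [b0 Sb] := three_sides_filling bm d00m d10m d00y d10y.
have [t0 St] := three_sides_filling tm d01m d11m d01y d11y.
have [|l0 Sl] := three_sides_filling lm d00m d01m _ (etrans d01y tl); first by rewrite -bl.
have [|r0 Sr] := three_sides_filling rm d10m d11m _ (etrans d11y tr); first by rewrite -br.
have [b0m _ _ _] := square_edges Sb; have [b00 b01 _ _] := square_corners Sb.
have [t0m _ _ _] := square_edges St; have [t00 t01 _ _] := square_corners St.
have [l0m _ _ _] := square_edges Sl; have [l00 l01 _ _] := square_corners Sl.
have [r0m _ _ _] := square_edges Sr; have [r00 r01 _ _] := square_corners Sr.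
have Q0 : square_in X b0 t0 l0 r0.
  have eb : b0 zero = x0 by rewrite b00.
  have et : t0 one = x0 by rewrite t01.
  apply/square_concatP => //; rewrite ?b00 ?b01 ?t00 ?t01 ?l00 ?l01 ?r00 ?r01//.
  rewrite d00x d11x; apply: pi1_inj.
  - by apply: maps_in_concat => //; rewrite b01 r00.
  - by apply: maps_in_concat => //; rewrite l01 t00.
  - have [b0c t0c l0c r0c] : [/\ maps_in setT b0, maps_in setT t0, maps_in setT l0 &
        maps_in setT r0].
      by split; apply: maps_in_setT; [case: b0m|case: t0m|case: l0m|case: r0m].
    rewrite -{1}eb -et; apply/square_concatP => //;
      rewrite ?b00 ?b01 ?t00 ?t01 ?l00 ?l01 ?r00 ?r01//.
    apply: (square_of_open_box Q); apply: square_setT; apply: square_flip.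
    + exact: Sb. + exact: St. + exact: Sl. + exact: Sr.
exact: square_of_open_box Q0 Sb St Sl Sr.
Qed.

(** The path c runs from y to a point of X.  The square is the side face over
an end point needed in the construction of sweeps: d joins the base point to y
in Y, and e joins it in X to the end of c. *)
Lemma corner_path y : exists c, (X y -> c = cst y) /\
  exists d e, [/\ continuous d, d zero = x0, d one = y, maps_in X e /\ e zero = x0 &
    square_in setT e c d (cst (e one))].
Proof.
have [Xy|nXy] := pselect (X y).
  have [d dm [dx dy]] := pathX Xy.
  exists (cst y); split=> //; exists d, d; split=> //; first exact: dm.1.
  exists (fun z => d (clamp (Num.max (ival z.1) (ival z.2)))).
    by apply: maps_in_setT; have := dm.1 => ?; cont.
  split=> u /=; rewrite ?ival0 ?ival1 ?(max_idPl (ival_ge0 u)) ?(max_idPr (ival_ge0 u))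
    ?(max_idPr (ival_le1 u)) ?(max_idPl (ival_le1 u)) ?ivalK//; by rewrite -oneE.
have X0 : X x0.
  have [|||q [_ Xq] S] := @pi1_surj (cst x0); [exact: const_continuous|done|done|].
  by have [_ _ q0 _] := square_corners S; have := Xq zero; rewrite q0.
have [d dc [dx dy]] := pathY y.
exists (rev d); split=> //; exists d, (cst x0); split=> //.
  by split=> //; split=> //; exact: const_continuous.
exists (fun z => d (clamp (ival z.2 * (1 - ival z.1)))).
  by apply: maps_in_setT; cont.
split=> u /=; rewrite ?ival0 ?ival1 ?subr0 ?subrr ?mul0r ?mulr0 ?mul1r ?mulr1
   ?ivalK//; by rewrite -zeroE.
Qed.

Definition corner y : I -> Y := projT1 (cid (corner_path y)).

Lemma corner_in y : X y -> corner y = cst y.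
Proof. exact: (projT2 (cid (corner_path y))).1. Qed.

(** The path is joined to the base point by its ends, the resulting loop is
replaced by one in X by surjectivity of the map of fundamental groups, and the
ends are moved away again along paths in X. *)
Lemma straighten_path p : continuous p -> exists S : I * I -> Y,
  [/\ continuous S, forall u, X (S (u, one)), (forall u, X (p u)) -> S = p \o fst &
    [/\ forall u, S (u, zero) = p u, forall v, S (zero, v) = corner (p zero) v &
      forall v, S (one, v) = corner (p one) v]].
Proof.
move=> pc; have [pX|npX] := pselect (forall u, X (p u)).
  exists (p \o fst); split=> //=.
    by apply: comp_continuous => // ?; exact: cvg_fst.
  by split=> // e; rewrite corner_in.
rewrite /corner.
case: cid => c /= [_ [d [e [dc dx dy [em ex] L]]]].
case: cid => c' /= [_ [d' [e' [d'c d'x d'y [e'm e'x] L']]]].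
have pm := maps_in_setT pc.
have [p2 S2] := three_sides_filling pm (maps_in_setT dc) (maps_in_setT d'c) dy d'y.
have [p20 p21 _ _] := square_corners S2.
have [[p2c _] _ _ _] := square_edges S2.
have [||p3 p3m S3] := pi1_surj p2c; [by rewrite p20|by rewrite p21|].
have [_ _ p30 p31] := square_corners S3.
(* p3 is a loop in X, with sweeps d and d' from its ends to those of p *)
have S4 : square_in setT p3 p d d'.
  apply: (square_of_open_box S2 S3 (square_triv pm)).
    by have := square_triv (maps_in_setT dc); rewrite dx dy.
  by have := square_triv (maps_in_setT d'c); rewrite d'x d'y.
have [||p4 S5] := three_sides_filling p3m (maps_in_rev em) (maps_in_rev e'm).
- by rewrite rev_one ex p30.
- by rewrite rev_one e'x p31.
have [p4m _ _ _] := square_edges S5.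
have [p40 p41 _ _] := square_corners S5.
have [Q [Qc _] [Qb Qt Ql Qr]] : square_in setT p p4 c c'.
  have := square_flip S5; rewrite !revK => /square_setT S6.
  apply: (square_of_open_box S6 S4 _ L L').
  have := square_triv (maps_in_setT p4m.1).
  by rewrite p40 p41 !rev_zero.
exists Q; split=> //.
by move=> u; rewrite Qt; exact: p4m.2.
Qed.

Definition sweep (p : I -> Y) : I * I -> Y :=
  if pselect (continuous p) is left pc then projT1 (cid (straighten_path pc))
  else p \o fst.

Lemma sweepP : is_sweep X corner sweep.
Proof.
move=> p pc; rewrite /sweep; case: pselect => // pc'.
exact: (projT2 (cid (straighten_path pc'))).
Qed.

Lemma straighten_square (q : I * I -> Y) : continuous q -> exists F : I * I -> Y,
  [/\ maps_in X F, (forall z, X (q z)) -> F = q &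
  [/\ forall u, F (u, zero) = sweep (fun v => q (v, zero)) (u, one),
      forall u, F (u, one) = sweep (fun v => q (v, one)) (u, one),
      forall u, F (zero, u) = sweep (fun v => q (zero, v)) (u, one) &
      forall u, F (one, u) = sweep (fun v => q (one, v)) (u, one)]].
Proof.
move=> qc.
have cb : continuous (fun v => q (v, zero)) by cont.
have ct : continuous (fun v => q (v, one)) by cont.
have cl : continuous (fun v => q (zero, v)) by cont.
have cr : continuous (fun v => q (one, v)) by cont.
have [b1 b2 b3 [b4 b5 b6]] := sweepP cb.
have [t1 t2 t3 [t4 t5 t6]] := sweepP ct.
have [l1 l2 l3 [l4 l5 l6]] := sweepP cl.
have [r1 r2 r3 [r4 r5 r6]] := sweepP cr.
have [qX|nqX] := pselect (forall z, X (q z)).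
  by exists q; split=> //; split=> u; rewrite ?b3 ?t3 ?l3 ?r3.
have sq (f : I -> Y) (S : I * I -> Y) (c c' : I -> Y) :
    continuous S -> (forall u, S (u, zero) = f u) ->
    (forall v, S (zero, v) = c v) -> (forall v, S (one, v) = c' v) ->
    square_in setT f (fun u => S (u, one)) c c' by exists S.
have [|||||F Fm [Fb Ft Fl Fr]] := @square_refill
    (fun u => sweep (fun v => q (v, zero)) (u, one))
    (fun u => sweep (fun v => q (v, one)) (u, one))
    (fun u => sweep (fun v => q (zero, v)) (u, one))
    (fun u => sweep (fun v => q (one, v)) (u, one)).
- by split=> //; cont.
- by split=> //; cont.
- by split=> //; cont.
- by split=> //; cont.
- have Q : square_in setT (fun v => q (v, zero)) (fun v => q (v, one))
    (fun v => q (zero, v)) (fun v => q (one, v)) by exists q.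
  by apply: (square_of_open_box Q); [exact: sq b1 b4 b5 b6|exact: sq t1 t4 t5 t6
   |exact: sq l1 l4 l5 l6|exact: sq r1 r4 r5 r6].
by exists F.
Qed.

Definition refill (q : I * I -> Y) : I * I -> Y :=
  if pselect (continuous q) is left qc then projT1 (cid (straighten_square qc))
  else q.

Lemma refillP : is_refill X sweep refill.
Proof.
move=> q qc; rewrite /refill; case: pselect => // qc'.
exact: (projT2 (cid (straighten_square qc'))).
Qed.

Lemma straightening_exists : exists corner (sweep : (I -> Y) -> I * I -> Y) refill,
  [/\ forall y, X y -> corner y = cst y, is_sweep X corner sweep &
      is_refill X sweep refill].
Proof.
by exists corner, sweep, refill; split; [exact: corner_in|exact: sweepP|exact: refillP].
Qed.

End straightening.

(** * Euclidean discs *)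

Section euclidean.
Context {R : realType} {n : nat}.
Implicit Types v : 'rV[R]_n.

Definition enorm v : R := Num.sqrt (\sum_i v 0 i ^+ 2).

Lemma sumsq_ge0 v : 0 <= \sum_i v 0 i ^+ 2.
Proof. by apply: sumr_ge0 => i _; exact: sqr_ge0. Qed.

Lemma enorm_ge0 v : 0 <= enorm v. Proof. exact: sqrtr_ge0. Qed.

Lemma enormZ (a : R) v : 0 <= a -> enorm (a *: v) = a * enorm v.
Proof.
move=> a0; rewrite /enorm; under eq_bigr do rewrite mxE exprMn.
by rewrite -mulr_sumr sqrtrM ?sqr_ge0// sqrtr_sqr ger0_norm.
Qed.

Lemma disc_enorm v : disc v <-> enorm v <= 1.
Proof.
rewrite /disc /enorm /= -[X in _ <-> _ <= X]sqrtr1.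
by rewrite ler_sqrt.
Qed.

Lemma open_disc_enorm v : open_disc v <-> enorm v < 1.
Proof. by rewrite /open_disc /enorm /= -[X in _ <-> _ < X]sqrtr1 ltr_sqrt. Qed.

Lemma sphere_enorm v : sphere v <-> enorm v = 1.
Proof.
rewrite /sphere /enorm /=; split=> [->|]; first exact: sqrtr1.
move=> /(congr1 (fun x => x ^+ 2)); rewrite sqr_sqrtr ?expr1n//.
exact: sumsq_ge0.
Qed.


Lemma enorm_continuous : continuous enorm.
Proof.
apply: (@comp_continuous _ _ _ Num.sqrt (fun v => \sum_i v 0 i ^+ 2)).
  exact: sqrt_continuous.
apply: (@continuous_big _ _ (@GRing.add R) 0 xpredT) => [|i _].
  exact: add_continuous.
have c : continuous (fun v => v 0 i * v 0 i).
  by apply: mul_real_continuous; exact: coord_continuous.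
exact: c.
Qed.

Lemma scale_fun_continuous (S : topologicalType) (a : S -> R) (f : S -> 'rV[R]_n) :
  continuous a -> continuous f -> continuous (fun s => a s *: f s).
Proof. by move=> ac fc s; apply: cvgZ; [exact: ac|exact: fc]. Qed.

Definition disc_retraction v : 'rV[R]_n := (Num.max 1 (enorm v))^-1 *: v.

Lemma max1_neq0 (x : R) : Num.max 1 x != 0.
Proof. by rewrite gt_eqF// lt_max ltr01. Qed.

Lemma disc_retraction_disc v : disc (disc_retraction v).
Proof.
apply/disc_enorm; rewrite enormZ; last first.
  by rewrite invr_ge0 le_max ler01.
by rewrite mulrC ler_pdivrMr ?mul1r ?le_max ?lexx ?orbT// lt_max ltr01.
Qed.

Lemma disc_retraction_id v : disc v -> disc_retraction v = v.
Proof.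
by move=> /disc_enorm v1; rewrite /disc_retraction (max_idPl v1) invr1 scale1r.
Qed.

Lemma disc_retraction_continuous : continuous disc_retraction.
Proof.
apply: scale_fun_continuous; last exact: id_continuous.
apply: inv_real_continuous; last by move=> v; exact: max1_neq0.
apply: max_real_continuous; first exact: const_continuous.
exact: enorm_continuous.
Qed.

Lemma disc_closed : closed (@disc R n).
Proof.
rewrite (_ : @disc R n = [set v | enorm v <= 1]).
  by apply: closed_le_fun; [exact: enorm_continuous|exact: const_continuous].
by apply/seteqP; split=> v /disc_enorm.
Qed.

Lemma disc_compact : compact (@disc R n).
Proof.
have cube : compact [set v : 'rV[R]_n | forall i, `[(-1 : R), 1]%classic (v ord0 i)].
  apply: (@rV_compact R n (fun=> `[(-1 : R), 1]%classic)) => _.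
  exact: segment_compact.
apply: (subclosed_compact disc_closed cube).
move=> v vd i; rewrite /= in_itv /=.
have vi : v 0 i ^+ 2 <= 1.
  apply: le_trans vd; rewrite (bigD1 i)//= lerDl.
  by apply: sumr_ge0 => j _; exact: sqr_ge0.
by rewrite -ler_norml -(@expr_le1 _ 2)// real_normK// num_real.
Qed.

End euclidean.

(** * Radial flow of a CW-complex *)

Lemma hausdorff_pair (S T : topologicalType) :
  hausdorff_space S -> hausdorff_space T -> hausdorff_space (S * T)%type.
Proof.
move=> hS hT [p1 p2] [q1 q2] pq; congr pair.
- apply: hS => A B pA qB.
  have [|| [s t] [/= [As _] [Bs _]]] := pq (A `*` setT) (B `*` setT).
  + by exists (A, setT) => //; split=> //; exact: filterT.
  + by exists (B, setT) => //; split=> //; exact: filterT.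
  + by exists s.
- apply: hT => A B pA qB.
  have [|| [s t] [/= [_ At] [_ Bt]]] := pq (setT `*` A) (setT `*` B).
  + by exists (setT, A) => //; split=> //; exact: filterT.
  + by exists (setT, B) => //; split=> //; exact: filterT.
  + by exists t.
Qed.

Lemma within_comp_continuous (S T U : topologicalType) (D : set T) (f : T -> U)
    (g : S -> T) : {within D, continuous f} -> continuous g -> (forall s, D (g s)) ->
  continuous (fun s => f (g s)).
Proof.
move=> /subspace_continuousP fc gc gD s.
apply: (@cvg_comp _ _ _ g f _ _ _ _ (fc _ (gD s))) => P /= wP.
by apply: (@filterS _ (nbhs s) _ _ _ _ (gc s _ wP)) => t /=; apply.
Qed.

Lemma finite_bigcup_closed (J : Type) (T : topologicalType) (F : set J)
    (C : J -> set T) :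
  finite_set F -> (forall j, F j -> closed (C j)) -> closed (\bigcup_(j in F) C j).
Proof. move=> Ff Cc; exact: (@closed_bigcup _ {classic J}). Qed.

Lemma image_compact (S T : topologicalType) (f : S -> T) (K : set S) :
  continuous f -> compact K -> compact (f @` K).
Proof.
by move=> fc Kc; apply: continuous_compact => //; exact: continuous_subspaceT.
Qed.

Section radial_flow.
Context {R : realType} {Y : topologicalType} (cw : cw_structure R Y).
Local Notation cell := (cell cw).
Variable E : set cell.
Let A : set Y := \bigcup_(c in E) open_cell c.
Hypothesis Ecl : forall c, E c -> closed_cell c `<=` A.

Lemma cell_point (y : Y) : exists p : {c : cell & 'rV[R]_(cell_dim c)},
  open_disc (projT2 p) /\ cell_map (projT2 p) = y.
Proof. by have [c [v vo <-]] := cw_cover cw y; exists (existT _ c v). Qed.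

Definition addr y := projT1 (cid (cell_point y)).

Lemma addrP y : open_disc (projT2 (addr y)) /\ cell_map (projT2 (addr y)) = y.
Proof. exact: (projT2 (cid (cell_point y))). Qed.

Lemma addrE (c : cell) v : open_disc v -> addr (cell_map (c := c) v) = existT _ c v.
Proof.
move=> vo; have [] := addrP (cell_map v); move: (addr _) => [d w] /= wo e.
have dc : d = c.
  by apply: (@cw_disjoint _ _ cw _ _ (cell_map v)); [exists w | exists v].
by subst d; rewrite (cw_map_inj (mem_set wo) (mem_set vo) e).
Qed.

Lemma addr_ind (P : Y -> Prop) :
  (forall (c : cell) v, open_disc v -> P (cell_map (c := c) v)) -> forall y, P y.
Proof. by move=> H y; have [vo <-] := addrP y; exact: H. Qed.

Lemma open_cell_disjoint (c : cell) v :
  ~ E c -> open_disc v -> ~ A (cell_map (c := c) v).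
Proof.
move=> nEc vo [d Ed dv]; apply: nEc.
by rewrite (@cw_disjoint _ _ cw c d (cell_map v))//; exists v.
Qed.

(** The recursions on cells descend through the finitely many cells of lower
dimension that meet the boundary of a cell. *)
Lemma cell_boundary (c : cell) : exists F : set cell, [/\ finite_set F,
  forall d, F d -> (cell_dim d < cell_dim c)%N &
  forall v : 'rV[R]_(cell_dim c), enorm v = 1 ->
    exists d w, [/\ F d, open_disc w & cell_map (c := d) w = cell_map v]].
Proof.
have [F [Ff Fd Fs]] := cw_closure_finite c; exists F; split=> // v v1.
have [|d Fd' [w wo wE]] := Fs (cell_map v).
  by exists v => //; apply/sphere_enorm.
by exists d, w.
Qed.

Definition dim y := cell_dim (projT1 (addr y)).

(** At time l the radial coordinate has been multiplied by l.  A point that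
leaves its disc is moved to the boundary, where the remaining factor is l
times its norm; the fuel k bounds the dimension of the cells that are met.
The second component is zero until the point reaches A, and then measures the
excess of the remaining factor over one: its continuity is what makes the set
of points that have reached A a neighbourhood of A. *)
Fixpoint flow_fuel (k : nat) (y : Y) (l : R) : Y * R :=
  if pselect (A y) then (y, l - 1) else
  if k is k'.+1 then
    let: existT c v := addr y in
    if l * enorm v <= 1 then (cell_map (l *: v), 0)
    else flow_fuel k' (cell_map ((enorm v)^-1 *: v)) (l * enorm v)
  else (y, 0).

Lemma flow_fuel_in k y l : A y -> flow_fuel k y l = (y, l - 1).
Proof. by case: k => /= [|k]; case: pselect. Qed.

Lemma flow_fuelS k (c : cell) v l : open_disc v -> ~ A (cell_map (c := c) v) ->
  flow_fuel k.+1 (cell_map v) l = if l * enorm v <= 1 then (cell_map (l *: v), 0)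
    else flow_fuel k (cell_map ((enorm v)^-1 *: v)) (l * enorm v).
Proof. by move=> vo nA /=; case: pselect => [//|?]; rewrite addrE. Qed.

Lemma enorm_unit n (v : 'rV[R]_n) : enorm v != 0 -> enorm ((enorm v)^-1 *: v) = 1.
Proof. by move=> v0; rewrite enormZ ?mulVf// invr_ge0 enorm_ge0. Qed.

Lemma enorm_dim0 n (v : 'rV[R]_n) : n = 0%N -> enorm v = 0.
Proof. by move=> n0; subst n; rewrite /enorm big_ord0 sqrtr0. Qed.

Lemma boundary_dim (c : cell) v : enorm v = 1 ->
  (dim (cell_map (c := c) v) < cell_dim c)%N.
Proof.
have [F [_ Fd Fs]] := cell_boundary c.
by move=> /Fs[d [w [/Fd dc wo <-]]]; rewrite /dim addrE.
Qed.

(** Each passage to the boundary lowers the dimension of the cell, so fuel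
beyond the dimension is never spent. *)
Lemma flow_fuel_stable k m y l : (dim y <= k)%N -> (dim y <= m)%N ->
  flow_fuel k y l = flow_fuel m y l.
Proof.
have dim0 n y' l' : dim y' = 0%N -> flow_fuel n y' l' = flow_fuel 0 y' l'.
  move: y'; apply: addr_ind => c v vo; rewrite {1}/dim addrE// => c0; change (cell_dim c = 0%N) in c0.
  have [Ay|nAy] := pselect (A (cell_map v)); first by rewrite !flow_fuel_in.
  case: n => // n; rewrite flow_fuelS// (enorm_dim0 v c0) mulr0 ler01 /=.
  case: pselect => [//|?]; congr (cell_map _, _).
  by apply/rowP => -[i ic]; exfalso; rewrite c0 in ic.
elim: k m y l => [|k IH] m y l.
  by rewrite leqn0 => /eqP y0 _; rewrite [RHS]dim0.
case: m => [_|m]; first by rewrite leqn0 => /eqP y0; rewrite [LHS]dim0.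
move: y; apply: addr_ind => c v vo; rewrite /dim addrE// => ck cm; rewrite /= in ck cm.
have [Ay|nAy] := pselect (A (cell_map v)); first by rewrite !flow_fuel_in.
rewrite !flow_fuelS//; case: leP => // lv.
have v0 : enorm v != 0 by apply: contraTneq lv => ->; rewrite mulr0 ltNge ler01.
have := boundary_dim (enorm_unit v0) => dv.
by apply: IH; rewrite -ltnS; [exact: leq_trans dv ck|exact: leq_trans dv cm].
Qed.

Definition flow y l := flow_fuel (dim y) y l.

Lemma flow_in y l : A y -> flow y l = (y, l - 1).
Proof. exact: flow_fuel_in. Qed.

Lemma flow1 y : flow y 1 = (y, 0).
Proof.
have [Ay|] := pselect (A y); first by rewrite flow_in// subrr.
move: y; apply: addr_ind => c v vo nA.
rewrite /flow -(@flow_fuel_stable (dim (cell_map v)).+1)// flow_fuelS//.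
by rewrite mul1r scale1r ifT//; apply/ltW/open_disc_enorm.
Qed.

(** This formula and that of [flow_outer] hold on the whole closed disc; on
the boundary sphere, whose points belong to other cells, the former only
concerns time one and the latter is trivial. *)
Lemma flow_inner (c : cell) v l : ~ E c -> disc v -> 1 <= l -> l * enorm v <= 1 ->
  flow (cell_map (c := c) v) l = (cell_map (l *: v), 0).
Proof.
move=> nEc /disc_enorm v1 l1 lv.
have [vo|v1'] := ltP (enorm v) 1.
  have nA := open_cell_disjoint nEc ((open_disc_enorm v).2 vo).
  move/open_disc_enorm in vo.
  by rewrite /flow -(@flow_fuel_stable (dim (cell_map v)).+1)// flow_fuelS// lv.
have ve : enorm v = 1 by apply/le_anti; rewrite v1.
have -> : l = 1 by apply/le_anti; rewrite l1 andbT; move: lv; rewrite ve mulr1.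
by rewrite flow1 scale1r.
Qed.

Lemma flow_outer (c : cell) v l : ~ E c -> disc v -> 1 <= l -> 1 <= l * enorm v ->
  flow (cell_map (c := c) v) l =
  flow (cell_map ((enorm v)^-1 *: v)) (l * enorm v).
Proof.
move=> nEc vd l1 lv; have /disc_enorm v1 := vd.
have v0 : enorm v != 0 by apply: contraTneq lv => ->; rewrite mulr0 -ltNge ltr01.
have [lv'|lv'] := leP (l * enorm v) 1.
  have e : l * enorm v = 1 by apply/le_anti; rewrite lv'.
  rewrite flow_inner// e flow1; congr (cell_map (_ *: _), _).
  by apply: (mulIf v0); rewrite e mulVf.
have [vo|v1'] := ltP (enorm v) 1.
  have nA := open_cell_disjoint nEc ((open_disc_enorm v).2 vo).
  move/open_disc_enorm in vo.
  rewrite /flow -(@flow_fuel_stable (cell_dim c).+1)//; last by rewrite /dim addrE.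
  rewrite flow_fuelS// leNgt lv' /=; apply: flow_fuel_stable => //.
  by apply: ltnW; apply: boundary_dim; exact: enorm_unit.
have ve : enorm v = 1 by apply/le_anti; rewrite v1.
by rewrite ve invr1 scale1r mulr1.
Qed.

(** Composition with the retraction onto the disc makes the characteristic map
continuous on the whole space. *)
Definition cmap (c : cell) (v : 'rV[R]_(cell_dim c)) : Y :=
  cell_map (disc_retraction v).

Lemma cmap_continuous c : continuous (cmap (c := c)).
Proof.
apply: (within_comp_continuous (g := @disc_retraction R _)
  (@cw_map_continuous _ _ cw c)).
  exact: disc_retraction_continuous.
exact: disc_retraction_disc.
Qed.

Lemma cmapE c v : disc v -> cmap (c := c) v = cell_map v.
Proof. by move=> vd; rewrite /cmap disc_retraction_id. Qed.

Lemma closed_cell_compact (c : cell) : compact (closed_cell c).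
Proof.
exact: continuous_compact (@cw_map_continuous _ _ cw c) (@disc_compact R _).
Qed.

Lemma closed_cell_closed (c : cell) : closed (closed_cell c).
Proof. by apply: compact_closed; [exact: (cw_hausdorff cw)|exact: closed_cell_compact]. Qed.

Definition flow_graph (c : cell) (C : set (Y * R)) : set (Y * R) :=
  [set p | [/\ closed_cell c p.1, 1 <= p.2, p.2 <= 2 & C (flow p.1 p.2)]].

(** By induction on the dimension.  Over the disc the preimage splits into the
part where the flow stays in the cell and the part where it has reached the
boundary; the latter is the preimage of the graphs over finitely many cells of
lower dimension.  So it is compact over the disc, and its image is compact,
hence closed. *)
Lemma flow_graph_closed C (c : cell) : closed C -> closed (flow_graph c C).
Proof.
move=> Ccl; have [m] := ubnP (cell_dim c); elim: m c => // m IH c cm.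
have YRh : hausdorff_space (Y * R)%type.
  by apply: hausdorff_pair; [exact: (cw_hausdorff cw)|exact: Rhausdorff].
have [Ec|nEc] := pselect (E c).
  rewrite (_ : flow_graph c C = fst @^-1` closed_cell c `&` [set p | 1 <= p.2]
      `&` [set p | p.2 <= 2] `&` (fun p => (p.1, p.2 - 1)) @^-1` C).
    apply: closedI; [apply: closedI; [apply: closedI|]|].
    - apply: continuous_preimage_closed; first cont.
      exact: closed_cell_closed.
    - by apply: closed_le_fun; cont.
    - by apply: closed_le_fun; cont.
    - by apply: continuous_preimage_closed => //; cont.
  apply/seteqP; split=> -[y l] /=.
    by move=> [yc l1 l2]; rewrite flow_in//; exact: Ecl yc.
  by move=> [[[yc l1] l2] yC]; split=> //; rewrite flow_in//; exact: Ecl yc.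
have [F [Ff Fd Fs]] := cell_boundary c.
pose n := cell_dim c.
pose B := \bigcup_(d in F) flow_graph d C.
have Bcl : closed B.
  by apply: finite_bigcup_closed => // d /Fd dc; apply: IH; exact: leq_trans dc _.
(* m1 and m2 follow the flow inside the cell and up to its boundary; the bound
1/2 makes m2 continuous at the centre, and holds on the part where m2 is used
since times are at most 2 *)
pose m1 (q : 'rV[R]_n * R) : Y * R := (cmap (q.2 *: q.1), 0).
pose m2 (q : 'rV[R]_n * R) : Y * R :=
  (cmap ((Num.max (enorm q.1) 2^-1)^-1 *: q.1), q.2 * enorm q.1).
have ec : continuous (fun q : 'rV[R]_n * R => enorm q.1).
  by apply: comp_continuous; [exact: enorm_continuous|cont].
have lec : continuous (fun q : 'rV[R]_n * R => q.2 * enorm q.1).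
  by apply: mul_real_continuous => //; cont.
have m1c : continuous m1.
  apply: pair_continuous; last exact: const_continuous.
  apply: comp_continuous; first exact: cmap_continuous.
  by apply: scale_fun_continuous; cont.
have m2c : continuous m2.
  apply: pair_continuous => //.
  apply: comp_continuous; first exact: cmap_continuous.
  apply: scale_fun_continuous; last cont.
  apply: inv_real_continuous.
    by apply: max_real_continuous => //; exact: const_continuous.
  by move=> q; rewrite gt_eqF// lt_max invr_gt0 ltr0n orbT.
pose K := [set q : 'rV[R]_n * R | disc q.1] `&` [set q | 1 <= q.2]
  `&` [set q | q.2 <= 2] `&`
  ([set q | q.2 * enorm q.1 <= 1] `&` m1 @^-1` C `|`
   [set q | 1 <= q.2 * enorm q.1] `&` m2 @^-1` B).
have Kc : compact K.
  apply: (@subclosed_compact _ _ (@disc R n `*` `[1 : R, 2 : R]%classic)).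
  - apply: closedI; [apply: closedI; [apply: closedI|]|apply: closedU; apply: closedI].
    + apply: (continuous_preimage_closed (f := fst)); first cont.
      exact: disc_closed.
    + by apply: closed_le_fun; cont.
    + by apply: closed_le_fun; cont.
    + by apply: closed_le_fun => //; cont.
    + exact: continuous_preimage_closed.
    + by apply: closed_le_fun => //; cont.
    + exact: continuous_preimage_closed.
  - by apply: compact_setX; [exact: disc_compact|exact: segment_compact].
  - move=> [v l] [[[/= vd l1] l2] _]; split=> //=.
    by rewrite in_itv /= l1 l2.
suff -> : flow_graph c C = (fun q => (cmap q.1, q.2)) @` K.
  apply: compact_closed => //; apply: image_compact => //.
  apply: pair_continuous; last cont.
  by apply: comp_continuous; [exact: cmap_continuous|cont].
have key (v : 'rV[R]_n) l : disc v -> 1 <= l -> l <= 2 ->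
    C (flow (cell_map v) l) <-> K (v, l).
  move=> vd l1 l2; have /disc_enorm v1 := vd.
  have inner : l * enorm v <= 1 -> m1 (v, l) = flow (cell_map v) l.
    move=> lv; rewrite flow_inner// /m1 /= cmapE//.
    by apply/disc_enorm; rewrite enormZ// (le_trans _ l1).
  have outer : 1 <= l * enorm v -> B (m2 (v, l)) <-> C (flow (cell_map v) l).
    move=> lv; rewrite flow_outer// /m2 /=.
    have v2 : 2^-1 <= enorm v by nra.
    have v0 : enorm v != 0 by apply: contraTneq v2 => ->; rewrite -ltNge; lra.
    have u1 := enorm_unit v0.
    rewrite (max_idPl v2) cmapE; last by apply/disc_enorm; rewrite u1.
    split=> [[d _ []]//|Cl].
    have [d [w [Fd' wo wE]]] := Fs _ u1.
    exists d => //; split=> //=; last by nra.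
    by rewrite -wE; exists w => //; apply/disc_enorm/ltW/open_disc_enorm.
  split=> [Cl|[_ [[/= lv]|[/= lv]]]].
  - split=> //=; have [lv|/ltW lv] := leP (l * enorm v) 1.
      by left; split=> //=; rewrite inner.
    by right; split=> //=; apply/outer.
  - by rewrite inner.
  - by move/outer; apply.
apply/seteqP; split=> [[y l] [/= [v vd <-] l1 l2 Cl]|_ [[v l] vK <-]].
  by exists (v, l); [apply/key | rewrite /= cmapE].
have [[[/= vd l1] l2] _] := vK.
by rewrite /= cmapE//; split=> //=; [exists v | apply/key].
Qed.

(** Times are truncated to [1, 2], where the flow is defined, to obtain a map
on the whole product. *)
Definition clamp12 (l : R) := Num.max 1 (Num.min 2 l).

Lemma clamp12P l : 1 <= clamp12 l /\ clamp12 l <= 2.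
Proof.
by rewrite /clamp12; split; [rewrite le_max lexx|rewrite ge_max ge_min lexx; lra].
Qed.

Lemma clamp12_id l : 1 <= l -> l <= 2 -> clamp12 l = l.
Proof. by move=> l1 l2; rewrite /clamp12 (min_idPr l2) (max_idPr l1). Qed.

Lemma clamp12_continuous : continuous clamp12.
Proof. by rewrite /clamp12; cont. Qed.

Definition cflow (p : Y * R) := flow p.1 (clamp12 p.2).

(** The weak topology of Y controls closed subsets of Y rather than of a
product with R.  Therefore a compact interval of times around the given one is
chosen first; the points that meet C within this interval form a closed set
because they do so in each closed cell, by projection of a compact set. *)
Lemma cflow_continuous : continuous cflow.
Proof.
apply/continuous_closedP => C Ccl.
rewrite -openC openE => -[y0 l0] /= nC; rewrite /interior /=.
have [c [v0 v0o v0E]] := cw_cover cw y0.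
have y0c : closed_cell c y0 by exists v0 => //; apply/disc_enorm/ltW/open_disc_enorm.
set m0 := clamp12 l0.
have Scl : closed [set l | flow_graph c C (y0, l)].
  apply: (continuous_preimage_closed (f := pair y0)); first cont.
  exact: flow_graph_closed.
have : nbhs m0 (~` [set l | flow_graph c C (y0, l)]).
  apply: open_nbhs_nbhs; split; first by rewrite openC.
  by move=> [_ _ _]; exact: nC.
move=> /nbhs_ballP[e /= e0 em].
(* half of e is left for the variation of the truncated time below *)
pose bad := [set y | exists l, [/\ 1 <= l, l <= 2, m0 - e / 2 <= l, l <= m0 + e / 2 &
  C (flow y l)]].
have badcl : closed bad.
  apply: (@cw_weak _ _ cw) => d.
  rewrite (_ : bad `&` closed_cell d = fst @` (flow_graph d C `&`
      ([set p | m0 - e / 2 <= p.2] `&` [set p | p.2 <= m0 + e / 2]))).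
    apply: compact_closed; first exact: (cw_hausdorff cw).
    apply: image_compact; first cont.
    apply: (@subclosed_compact _ _ (closed_cell d `*` `[1 : R, 2 : R]%classic)).
    - apply: closedI; first exact: flow_graph_closed.
      by apply: closedI; apply: closed_le_fun; cont.
    - by apply: compact_setX; [exact: closed_cell_compact|exact: segment_compact].
    - by move=> [y l] [[/= yd l1 l2 _] _]; split=> //=; rewrite in_itv /= l1 l2.
  apply/seteqP; split=> [y [[l [l1 l2 le le' Cl] yd]]|_ [[y l] [[/= yd l1 l2 Cl] [/= le le']] <-]].
    by exists (y, l).
  by split=> //; exists l.
have nbad : ~ bad y0.
  move=> [l [l1 l2 le le' Cl]].
  apply: (em l); last by split.
  by rewrite /ball /= ltr_norml; apply/andP; split; lra.
have ny : nbhs y0 (~` bad).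
  by apply: open_nbhs_nbhs; split; first rewrite openC.
have nl : nbhs l0 (clamp12 @^-1` ball m0 (e / 2)).
  by apply: clamp12_continuous; apply: nbhsx_ballx; rewrite divr_gt0.
exists (~` bad, clamp12 @^-1` ball m0 (e / 2)) => // -[y l] /= [nby bl] Cl.
apply: nby; exists (clamp12 l); have [l1 l2] := clamp12P l.
by move: bl; rewrite /ball /= ltr_norml => /andP[? ?]; split=> //; lra.
Qed.

Lemma flow_pos_in y l : 0 < (flow y l).2 -> A (flow y l).1.
Proof.
rewrite /flow; move: (dim y) => k; elim: k y l => [|k IH] y' l /=.
  by case: pselect => [|?] //=; rewrite ltxx.
case: pselect => [|?] //=; case: (addr y') => c v.
by case: ifP => _; [rewrite ltxx|exact: IH].
Qed.

Lemma flow_subcomplex (G : set cell) (X := \bigcup_(c in G) open_cell c) y l :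
  (forall c, G c -> closed_cell c `<=` X) -> 1 <= l -> X y -> X (flow y l).1.
Proof.
move=> Xcl; rewrite /flow; move: (dim y) => k; elim: k y l => [|k IH] y' l l1 Xy /=.
  by case: pselect.
case: pselect => [|nA] //= {nA}; move: y' Xy; apply: addr_ind => c v vo [d Gd dv].
have cd : c = d.
  by apply: (@cw_disjoint _ _ cw _ _ (cell_map v)) => //; exists v.
move: dv => _; subst d; rewrite addrE//; case: leP => [lv|lv] /=.
  apply: (Xcl c) => //; exists (l *: v) => //.
  by apply/disc_enorm; rewrite enormZ// (le_trans _ l1).
apply: IH; first exact: ltW.
apply: (Xcl c) => //; eexists; last by reflexivity.
apply/disc_enorm; rewrite enorm_unit//.
by apply: contraTneq lv => ->; rewrite mulr0 ltNge ler01.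
Qed.

End radial_flow.

(** The flow from time one to time two; N consists of the points that reach A
before time two, so that the excess is positive. *)
Lemma subcomplex_retraction (R : realType) (Y : topologicalType)
    (cw : cw_structure R Y) (X A : set Y) :
  subcomplex cw X -> subcomplex cw A ->
  exists (h : Y * unit_interval R -> Y) (N : set Y),
  [/\ continuous h, forall y, h (y, zero) = y, forall a s, A a -> h (a, s) = a,
      forall x s, X x -> X (h (x, s)) &
      [/\ open N, A `<=` N & forall y, N y -> A (h (y, one))]].
Proof.
move=> [G XE Gcl] [E AE Ecl]; subst X A.
pose time (s : unit_interval R) := 1 + ival s.
have time12 s : clamp12 (time s) = time s.
  by rewrite clamp12_id// /time ?lerDl ?ival_ge0//; have := ival_le1 s; lra.
exists (fun p => (cflow E (p.1, time p.2)).1), [set y | 0 < (cflow E (y, 2)).2].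
split.
- apply: fst_comp_continuous.
  apply: comp_continuous; first exact: cflow_continuous.
  by rewrite /time; cont.
- by move=> y; rewrite /cflow /= time12 /time ival0 addr0 flow1.
- by move=> a s Aa; rewrite /cflow /= flow_in.
- by move=> x s Xx; apply: flow_subcomplex => //; case: (clamp12P (time s)).
split.
- rewrite (_ : [set _ | _] = (fun y => (cflow E (y, 2)).2) @^-1` [set r | 0 < r])//.
  apply: open_comp; last exact: open_gt.
  move=> y _; apply: (snd_comp_continuous (f := fun y => cflow E (y, 2))).
  apply: comp_continuous; first exact: cflow_continuous.
  cont.
- move=> a Aa /=; rewrite /cflow flow_in//= clamp12_id ?lexx//; lra.
- move=> y /=; rewrite /cflow /= time12 /time ival1 clamp12_id ?lexx//; last lra.
  by rewrite (_ : 1 + 1 = 2 :> R)//; exact: flow_pos_in.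
Qed.

(** * Dyadic subdivision *)

Section subdivision.
Context {R : realType}.
Local Notation I := (unit_interval R).

Definition lo (u : I) : I := clamp (ival u / 2).
Definition hi (u : I) : I := clamp ((ival u + 1) / 2).

Lemma lo_zero : lo zero = zero. Proof. by rewrite /lo ival0 mul0r. Qed.
Lemma lo_one : lo one = hi zero.
Proof. by rewrite /lo /hi ival0 ival1 add0r. Qed.
Lemma hi_one : hi one = one.
Proof. by rewrite /hi ival1 oneE; congr clamp; lra. Qed.

Lemma ival_lo u : ival (lo u) = ival u / 2.
Proof. by rewrite clampK//; have := ival_ge0 u; have := ival_le1 u; lra. Qed.
Lemma ival_hi u : ival (hi u) = (ival u + 1) / 2.
Proof. by rewrite clampK//; have := ival_ge0 u; have := ival_le1 u; lra. Qed.

Lemma lo_continuous : continuous lo. Proof. by rewrite /lo; cont. Qed.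
Lemma hi_continuous : continuous hi. Proof. by rewrite /hi; cont. Qed.

Section glue.
Context {T : topologicalType}.
Implicit Types f g : I * I -> T.

Definition glue_h f g : I * I -> T :=
  fun z => concat (fun u => f (u, z.2)) (fun u => g (u, z.2)) z.1.
Definition glue_v f g : I * I -> T :=
  fun z => concat (fun u => f (z.1, u)) (fun u => g (z.1, u)) z.2.

Lemma maps_in_glue_h (B : set T) f g : maps_in B f -> maps_in B g ->
  (forall u, f (one, u) = g (zero, u)) -> maps_in B (glue_h f g).
Proof.
move=> [fc fB] [gc gB] fg; split; last first.
  by move=> z; rewrite /glue_h /concat; case: ifP.
apply: if_le_continuous; [cont..|].
by move=> s ->; rewrite divff ?pnatr_eq0// subrr -oneE -zeroE.
Qed.

Lemma maps_in_glue_v (B : set T) f g : maps_in B f -> maps_in B g ->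
  (forall u, f (u, one) = g (u, zero)) -> maps_in B (glue_v f g).
Proof.
move=> [fc fB] [gc gB] fg; split; last first.
  by move=> z; rewrite /glue_v /concat; case: ifP.
apply: if_le_continuous; [cont..|].
by move=> s ->; rewrite divff ?pnatr_eq0// subrr -oneE -zeroE.
Qed.
End glue.

Lemma concat_halves (T : topologicalType) (p : I -> T) :
  concat (p \o lo) (p \o hi) = p.
Proof.
apply/funext => u; rewrite /concat; case: leP => u2 /=;
  have := ival_ge0 u; have := ival_le1 u => u1 u0; rewrite /lo /hi clampK; do ?[apply/andP; split; lra];
  by rewrite -[in RHS](ivalK u); congr (p (clamp _)); lra.
Qed.

End subdivision.

Section iterated_straightening.
Context {R : realType} {Y : topologicalType} (X : set Y).
Local Notation I := (unit_interval R).
Variables (corner : Y -> I -> Y) (sweep : (I -> Y) -> I * I -> Y)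
  (refill : (I * I -> Y) -> I * I -> Y).
Hypothesis sweepP : is_sweep X corner sweep.
Hypothesis refillP : is_refill X sweep refill.
Implicit Types (p : I -> Y) (q : I * I -> Y).

(** The sweeps of the dyadic pieces fit together because the ends of a sweep
depend on the end points of the path only. *)
Fixpoint sweep_iter k p : I * I -> Y :=
  if k is k'.+1 then glue_h (sweep_iter k' (p \o lo)) (sweep_iter k' (p \o hi))
  else sweep p.

Definition sub_square (a b : I -> I) q : I * I -> Y := fun z => q (a z.1, b z.2).

Fixpoint refill_iter k q : I * I -> Y :=
  if k is k'.+1 then
    glue_v (glue_h (refill_iter k' (sub_square lo lo q))
                   (refill_iter k' (sub_square hi lo q)))
           (glue_h (refill_iter k' (sub_square lo hi q))
                   (refill_iter k' (sub_square hi hi q)))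
  else refill q.

Lemma half_continuous p : continuous p ->
  continuous (p \o lo) /\ continuous (p \o hi).
Proof.
by move=> pc; split; apply: comp_continuous => //;
  [exact: lo_continuous|exact: hi_continuous].
Qed.

Lemma sub_square_continuous a b q : continuous a -> continuous b ->
  continuous q -> continuous (sub_square a b q).
Proof. by move=> ac bc qc; rewrite /sub_square; cont. Qed.

Lemma sweep_iterP k p : continuous p ->
  [/\ continuous (sweep_iter k p), forall u, X (sweep_iter k p (u, one)),
    (forall u, X (p u)) -> sweep_iter k p = p \o fst &
    [/\ forall u, sweep_iter k p (u, zero) = p u,
      forall v, sweep_iter k p (zero, v) = corner (p zero) v &
      forall v, sweep_iter k p (one, v) = corner (p one) v]].
Proof.
elim: k p => [|k IH] p pc; first exact: sweepP.
have [pl ph] := half_continuous pc.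
have [l1 l2 l3 [l4 l5 l6]] := IH _ pl; have [h1 h2 h3 [h4 h5 h6]] := IH _ ph.
have lh v : sweep_iter k (p \o lo) (one, v) = sweep_iter k (p \o hi) (zero, v).
  by rewrite l6 h5 /= lo_one.
split=> /=.
- by have [] := maps_in_glue_h (maps_in_setT l1) (maps_in_setT h1) lh.
- by move=> u; rewrite /glue_h /concat /=; case: ifP.
- move=> pX; rewrite l3; last by move=> u; exact: pX.
  rewrite h3; last by move=> u; exact: pX.
  by apply/funext => z; rewrite -[in RHS](concat_halves p).
split=> u; rewrite /glue_h /=.
- rewrite -[in RHS](concat_halves p).
  by congr (concat _ _ u); apply/funext => v; rewrite ?l4 ?h4.
- by rewrite concat_zero l5 /= lo_zero.
- by rewrite concat_one ?h6 /= ?hi_one.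
Qed.

(** The edges of the result are those swept by [sweep_iter]; by the induction
hypothesis this makes the four quarters agree along their common edges. *)
Lemma refill_iterP k q : continuous q ->
  maps_in X (refill_iter k q) /\
  [/\ forall u, refill_iter k q (u, zero) = sweep_iter k (fun v => q (v, zero)) (u, one),
      forall u, refill_iter k q (u, one) = sweep_iter k (fun v => q (v, one)) (u, one),
      forall u, refill_iter k q (zero, u) = sweep_iter k (fun v => q (zero, v)) (u, one) &
      forall u, refill_iter k q (one, u) = sweep_iter k (fun v => q (one, v)) (u, one)].
Proof.
elim: k q => [|k IH] q qc; first by have [] := refillP qc.
have lc := @lo_continuous R; have hc := @hi_continuous R.
have [ll [ll1 ll2 ll3 ll4]] := IH _ (sub_square_continuous lc lc qc).
have [hl [hl1 hl2 hl3 hl4]] := IH _ (sub_square_continuous hc lc qc).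
have [lh [lh1 lh2 lh3 lh4]] := IH _ (sub_square_continuous lc hc qc).
have [hh [hh1 hh2 hh3 hh4]] := IH _ (sub_square_continuous hc hc qc).
have eb u : refill_iter k (sub_square lo lo q) (one, u) =
            refill_iter k (sub_square hi lo q) (zero, u).
  by rewrite ll4 hl3 /sub_square /= lo_one.
have et u : refill_iter k (sub_square lo hi q) (one, u) =
            refill_iter k (sub_square hi hi q) (zero, u).
  by rewrite lh4 hh3 /sub_square /= lo_one.
have el u : refill_iter k (sub_square lo lo q) (u, one) =
            refill_iter k (sub_square lo hi q) (u, zero).
  by rewrite ll2 lh1 /sub_square /= lo_one.
have er u : refill_iter k (sub_square hi lo q) (u, one) =
            refill_iter k (sub_square hi hi q) (u, zero).
  by rewrite hl2 hh1 /sub_square /= lo_one.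
split.
  apply: maps_in_glue_v; [exact: maps_in_glue_h..|].
  by move=> u; rewrite /glue_h /concat /=; case: ifP.
split=> u; rewrite /= /glue_v /glue_h /=.
- rewrite concat_zero /=; congr (concat _ _ u); apply/funext => v.
    by rewrite ll1 /sub_square /= lo_zero.
  by rewrite hl1 /sub_square /= lo_zero.
- rewrite concat_one /=; last first.
    by congr (concat _ _ u); apply/funext => v.
  congr (concat _ _ u); apply/funext => v.
    by rewrite lh2 /sub_square /= hi_one.
  by rewrite hh2 /sub_square /= hi_one.
- congr (concat _ _ u); apply/funext => v; rewrite concat_zero.
    by rewrite ll3 /sub_square /= lo_zero.
  by rewrite lh3 /sub_square /= lo_zero.
- congr (concat _ _ u); apply/funext => v; rewrite concat_one //.
    by rewrite hl4 /sub_square /= hi_one.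
  by rewrite hh4 /sub_square /= hi_one.
Qed.

Section families.
Variables (n : nat) (K : simplicial_complex n) (A : set Y).
Hypothesis AX : A `<=` X.
Local Notation Z := (polyhedral_product K).

(** The face may vary with the dyadic piece, but a single face must account
for all coordinates that leave A within the piece. *)
Fixpoint small_path k (p : 'I_n -> I -> Y) : Prop :=
  if k is k'.+1 then
    small_path k' (fun i => p i \o lo) /\ small_path k' (fun i => p i \o hi)
  else exists2 s : {set 'I_n}, s \in faces K & forall i t, i \notin s -> A (p i t).

Fixpoint small_square k (q : 'I_n -> I * I -> Y) : Prop :=
  if k is k'.+1 then
    [/\ small_square k' (fun i => sub_square lo lo (q i)),
        small_square k' (fun i => sub_square hi lo (q i)),
        small_square k' (fun i => sub_square lo hi (q i)) &
        small_square k' (fun i => sub_square hi hi (q i))]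
  else exists2 s : {set 'I_n}, s \in faces K & forall i z, i \notin s -> A (q i z).

Lemma small_square_path k (p : 'I_n -> I -> Y) :
  small_square k (fun i z => p i z.1) -> small_path k p.
Proof.
elim: k p => [|k IH] p /=; last first.
  by move=> [ll hl _ _]; split; [exact: (IH _ ll)|exact: (IH _ hl)].
by move=> [s sK sA]; exists s => // i t /(sA i (t, zero)).
Qed.

(** On a small piece the coordinates outside the face are in A, hence in X,
where sweeps do not move them. *)
Lemma sweep_iter_polyhedral k (p : 'I_n -> I -> Y) : (forall i, continuous (p i)) -> small_path k p ->
  (forall z, Z setT A (fun i => sweep_iter k (p i) z)) /\
  (forall u, Z X A (fun i => sweep_iter k (p i) (u, one))).
Proof.
elim: k p => [|k IH] p pc.
  move=> [s sK sA] /=.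
  have eA i : i \notin s -> sweep (p i) = p i \o fst.
    by move=> si; have [_ _ + _] := sweepP (pc i); apply => u; exact/AX/sA.
  split=> [z|u]; exists s => // i; case: ifPn => // si.
  - by rewrite eA//; exact: sA.
  - by have [_ + _ _] := sweepP (pc i); apply.
  - by rewrite eA//; exact: sA.
move=> [sl sh].
have [l1 l2] := IH _ (fun i => (half_continuous (pc i)).1) sl.
have [h1 h2] := IH _ (fun i => (half_continuous (pc i)).2) sh.
split=> [z|u]; rewrite /= /glue_h /concat /=.
  by case: (ival z.1 <= 2^-1).
by case: (ival u <= 2^-1).
Qed.

Lemma refill_iter_polyhedral k (q : 'I_n -> I * I -> Y) : (forall i, continuous (q i)) ->
  small_square k q -> forall z, Z X A (fun i => refill_iter k (q i) z).
Proof.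
have lc := @lo_continuous R; have hc := @hi_continuous R.
elim: k q => [|k IH] q qc.
  move=> [s sK sA] z /=; exists s => // i.
  have [[_ rX] rE _] := refillP (qc i).
  case: ifPn => si; first exact: rX.
  rewrite rE; last by move=> z'; exact/AX/sA.
  exact: sA.
move=> [sll shl slh shh] z.
have ll := IH _ (fun i => sub_square_continuous lc lc (qc i)) sll.
have hl := IH _ (fun i => sub_square_continuous hc lc (qc i)) shl.
have lh := IH _ (fun i => sub_square_continuous lc hc (qc i)) slh.
have hh := IH _ (fun i => sub_square_continuous hc hc (qc i)) shh.
rewrite /= /glue_v /glue_h /concat /=.
by case: (ival z.2 <= 2^-1); case: (ival z.1 <= 2^-1).
Qed.

Definition close_by (e : R) (z z' : I * I) :=
  `|ival z'.1 - ival z.1| <= e /\ `|ival z'.2 - ival z.2| <= e.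

(** At level zero any two points of the square are within distance one;
restriction to a quarter halves distances. *)
Lemma lebesgue_small k (q : 'I_n -> I * I -> Y) :
  (forall z : I * I, exists2 s : {set 'I_n}, s \in faces K &
    forall i z', i \notin s -> close_by (2^-1 ^+ k) z z' -> A (q i z')) ->
  small_square k q.
Proof.
elim: k q => [|k IH] q qA /=.
  have [s sK sA] := qA (zero, zero); exists s => // i z si; apply: sA => //.
  rewrite expr0 /close_by /= !ival0 !subr0 !ger0_norm ?ival_ge0//.
  by split; exact: ival_le1.
have half a b : (forall u v, `|ival (a v) - ival (a u)| = `|ival v - ival u| / 2) ->
    (forall u v, `|ival (b v) - ival (b u)| = `|ival v - ival u| / 2) ->
    small_square k (fun i => sub_square a b (q i)).
  move=> ha hb; apply: IH => z; have [s sK sA] := qA (a z.1, b z.2).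
  exists s => // i z' si [z1 z2]; apply: sA => //.
  by split; rewrite /= ?ha ?hb exprS mulrC ler_pM2l ?invr_gt0.
have lo2 u v : `|ival (lo v) - ival (lo u)| = `|ival v - ival u| / 2.
  by rewrite !ival_lo -mulrBl normrM (ger0_norm (_ : 0 <= 2^-1)).
have hi2 u v : `|ival (hi v) - ival (hi u)| = `|ival v - ival u| / 2.
  rewrite !ival_hi -mulrBl normrM (ger0_norm (_ : 0 <= 2^-1))//.
  by congr (`| _ | / _); lra.
by split; apply: half.
Qed.

Lemma interval_compact : compact [set: I].
Proof.
rewrite (_ : setT = @clamp R @` `[0, 1]%classic).
  by apply: image_compact; [exact: clamp_continuous|exact: segment_compact].
apply/seteqP; split=> // u _; exists (ival u); last exact: ivalK.
by rewrite /= in_itv /= ival_ge0 ival_le1.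
Qed.

Lemma nbhs_close (z : I * I) (W : set (I * I)) : nbhs z W ->
  exists2 e : R, 0 < e & forall z', close_by e z z' -> W z'.
Proof.
move=> zW.
have cc : continuous (fun x : R * R => (clamp x.1, clamp x.2)) by cont.
have := cc (ival z.1, ival z.2) W; rewrite /= !ivalK -surjective_pairing.
move=> /(_ zW) /nbhs_ballP[e /= e0 eW]; exists (e / 2); first by rewrite divr_gt0.
move=> z' [z1 z2]; have := eW (ival z'.1, ival z'.2).
rewrite /= !ivalK -surjective_pairing; apply.
by split; rewrite /ball /= distrC; lra.
Qed.

(** A Lebesgue number for the cover of the parameter square by the open sets
on which a single face works. *)
Lemma small_square_ex (q : 'I_n -> I * I -> Y) :
  (forall z : I * I, exists2 s : {set 'I_n}, s \in faces K &
    forall i, i \notin s -> nbhs z [set z' | A (q i z')]) ->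
  exists k, small_square k q.
Proof.
move=> qA.
pose P (k : nat) (z : I * I) := exists2 s : {set 'I_n}, s \in faces K &
    forall i z', i \notin s -> close_by (2^-1 ^+ k) z z' -> A (q i z').
suff [k kP] : exists k, forall z, P k z by exists k; exact: lebesgue_small.
have cpt : compact [set: I * I].
  by rewrite -setXTT; apply: compact_setX; exact: interval_compact.
have : \forall k \near \oo, [set: I * I] `<=` P k.
  apply: (compact_near_coveringP _).1 cpt _ _ _ _ _ => z _.
  have [s sK sA] := qA z.
  have zW : nbhs z [set z' | forall i, i \notin s -> A (q i z')].
    apply: (@filter_forall _ _ (fun i z' => i \notin s -> A (q i z')) (nbhs z)) => i.
    have [_|si] := boolP (i \in s); first exact: filterE.
    by apply: filterS (sA i si).
  have [e e0 eW] := nbhs_close zW.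
  have e20 : 0 < e / 2 by rewrite divr_gt0.
  exists ([set z' | close_by (e / 2) z z'], [set k | 2^-1 ^+ k <= e / 2]); last first.
    move=> [z' k] [/= [z1 z2] ke]; exists s => // i z'' si [w1 w2].
    apply: (eW z'') => //; split.
      by move: z1 w1; rewrite !ler_norml => /andP[? ?] /andP[? ?]; apply/andP; split; lra.
    by move: z2 w2; rewrite !ler_norml => /andP[? ?] /andP[? ?]; apply/andP; split; lra.
  split=> /=.
    have c1 : continuous (fun z' : I * I => ival z'.1) by cont.
    have c2 : continuous (fun z' : I * I => ival z'.2) by cont.
    have n1 := c1 z _ (nbhsx_ballx (ival z.1) _ e20).
    have n2 := c2 z _ (nbhsx_ballx (ival z.2) _ e20).
    apply: (@filterS2 _ (nbhs z) _ _ _ _ _ n1 n2) => z'.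
    by rewrite /ball /= => ? ?; split; rewrite distrC ltW.
  have half1 : `|2^-1 : R| < 1 by rewrite ger0_norm//; lra.
  have n0 := cvg_expr half1 (nbhsx_ballx 0 _ e20).
  apply: (@filterS _ \oo _ _ _ _ n0) => k /=.
  rewrite /ball /= sub0r normrN ger0_norm; first exact: ltW.
  by rewrite exprn_ge0// invr_ge0.
by move=> [k _ kP]; exists k => z; exact: (kP k (leqnn k)).
Qed.

End families.
End iterated_straightening.

(** * Fundamental groups of polyhedral products *)

Section coordinates.

Lemma product_continuous n (S Y : topologicalType)
    (f : S -> prod_topology (fun _ : 'I_n => Y)) :
  (forall i, continuous (fun s => f s i)) -> continuous f.
Proof.
move=> fc s; apply/cvg_sup => i U [V [[W oW <-] Wfs] /filterS]; apply.
exact: fc (open_nbhs_nbhs (conj oW Wfs)).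
Qed.

Definition corestrict (S T : topologicalType) (B : set T) (f : S -> T)
  (fB : forall s, B (f s)) : S -> set_type B :=
  fun s => exist _ (f s) (mem_set (fB s)).

Lemma corestrict_continuous (S T : topologicalType) (B : set T) (f : S -> T)
    (fB : forall s, B (f s)) : continuous f -> continuous (corestrict fB).
Proof. by move=> fc; apply/continuous_comp_initial. Qed.

Lemma set_val_continuous (T : topologicalType) (B : set T) :
  continuous (set_val : B -> T).
Proof. exact: initial_continuous. Qed.

Lemma coord_set_val_continuous n (S Y : topologicalType)
    (B : set (prod_topology (fun _ : 'I_n => Y))) (f : S -> B) i :
  continuous f -> continuous (fun s => set_val (f s) i).
Proof.
move=> fc; apply: (@comp_continuous _ _ _ (fun y : prod_topology _ => y i)
  (fun s => set_val (f s))).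
  exact: (@proj_continuous _ (fun _ : 'I_n => Y) i).
by apply: comp_continuous => //; exact: set_val_continuous.
Qed.

End coordinates.

Section fundamental_group_inclusion.
Context {R : realType} {Y : topologicalType} (X : set Y) (x0 : X).
Local Notation I := (unit_interval R).
Local Notation incl := (subspace_incl X).
Hypothesis pi1XY : bijective (pi1_map R incl x0).

Lemma pi1_surj (p : I -> Y) : continuous p -> p zero = set_val x0 ->
  p one = set_val x0 ->
  exists2 q, maps_in X q & square_in setT p q (cst (set_val x0)) (cst (set_val x0)).
Proof.
move=> pc p0 p1; case: pi1XY => g _ gK.
pose P := mk_path (x := incl x0) (y := incl x0) pc p0 p1.
pose l := loop_repr (g (loop_class P)).
exists (fun u => set_val (l u)).
  split=> [|u]; last exact: set_valP.
  by apply: comp_continuous; [exact: set_val_continuous|exact: cts_fun].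
have : loop_class P = loop_class (incl \o l) by rewrite -pi1_mapE loop_reprK gK.
move=> /loop_classP[H [Hc H0 H1 Hx Hy]].
by exists H; split.
Qed.

Lemma pi1_inj (p q : I -> Y) : maps_in X p -> maps_in X q ->
  square_in setT p q (cst (set_val x0)) (cst (set_val x0)) ->
  square_in X p q (cst (set_val x0)) (cst (set_val x0)).
Proof.
move=> [pc pX] [qc qX] Q; have [p0 p1 q0 q1] := square_corners Q.
have e (f : I -> Y) (fX : forall u, X (f u)) u : f u = set_val x0 ->
    corestrict fX u = x0 by move=> ?; apply: val_inj.
pose P := mk_path (corestrict_continuous (fB := pX) pc) (e _ pX _ p0) (e _ pX _ p1).
pose P' := mk_path (corestrict_continuous (fB := qX) qc) (e _ qX _ q0) (e _ qX _ q1).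
have : loop_class P = loop_class P'.
  apply: (bij_inj pi1XY); rewrite !pi1_mapE; apply/loop_classP.
  by have [H [Hc _] [H0 H1 Hx Hy]] := Q; exists H; split.
move=> /loop_classP[H [Hc H0 H1 Hx Hy]].
exists (fun z => set_val (H z)).
  split=> [|z]; last exact: set_valP.
  by apply: comp_continuous => //; exact: set_val_continuous.
by split=> u; rewrite ?H0 ?H1 ?Hx ?Hy.
Qed.

End fundamental_group_inclusion.

Section polyhedral_inclusion.
Context {R : realType} {Y : topologicalType} {n : nat} (K : simplicial_complex n).
Variables (X A : set Y).
Local Notation I := (unit_interval R).
Hypothesis AX : A `<=` X.
Local Notation Yn := (prod_topology (fun _ : 'I_n => Y)).
Local Notation Z B := (polyhedral_product K B A).

Lemma polyhedral_product_sub (z : Z X) : Z setT (set_val z).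
Proof.
have [s sK zs] := set_valP z; exists s => // i.
by have := zs i; case: ifP.
Qed.

Definition polyhedral_incl : continuousType (Z X) (Z setT) :=
  mkcts (corestrict_continuous (fB := polyhedral_product_sub)
    (@set_val_continuous _ _)).

Lemma polyhedral_path_homotopic (B : set Y) (b b' : Z B)
    (p q : {path I from b to b' in Z B}) (H : 'I_n -> I * I -> Y) :
  (forall i, continuous (H i)) -> (forall z, Z B (fun i => H i z)) ->
  (forall i u, H i (u, zero) = set_val (p u) i) ->
  (forall i u, H i (u, one) = set_val (q u) i) ->
  (forall i u, H i (zero, u) = set_val b i) ->
  (forall i u, H i (one, u) = set_val b' i) -> path_homotopic p q.
Proof.
move=> Hc HB H0 H1 Hx Hy.
exists (corestrict (T := Yn) (f := fun z i => H i z) HB); split.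
- by apply: corestrict_continuous; exact: product_continuous.
- by move=> u; apply: val_inj; apply/funext => i; exact: H0.
- by move=> u; apply: val_inj; apply/funext => i; exact: H1.
- by move=> u; apply: val_inj; apply/funext => i; exact: Hx.
- by move=> u; apply: val_inj; apply/funext => i; exact: Hy.
Qed.

Lemma polyhedral_path (B : set Y) (b b' : Z B) (f : 'I_n -> I -> Y) :
  (forall i, continuous (f i)) -> (forall u, Z B (fun i => f i u)) ->
  (forall i, f i zero = set_val b i) -> (forall i, f i one = set_val b' i) ->
  exists p : {path I from b to b' in Z B}, forall u i, set_val (p u) i = f i u.
Proof.
move=> fc fB f0 f1.
have gc : continuous (corestrict (T := Yn) (f := fun u i => f i u) fB).
  by apply: corestrict_continuous; exact: product_continuous.
have g0 : corestrict (T := Yn) (f := fun u i => f i u) fB zero = b.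
  by apply: val_inj; apply/funext => i; exact: f0.
have g1 : corestrict (T := Yn) (f := fun u i => f i u) fB one = b'.
  by apply: val_inj; apply/funext => i; exact: f1.
by exists (mk_path gc g0 g1).
Qed.

Section deformation.
Variables (h : Y * I -> Y) (N : set Y).
Hypotheses (hc : continuous h) (h0 : forall y, h (y, zero) = y)
  (hA : forall a s, A a -> h (a, s) = a)
  (hX : forall x s, X x -> X (h (x, s)))
  (oN : open N) (AN : A `<=` N) (hN : forall y, N y -> A (h (y, one))).
Variables (corner : Y -> I -> Y) (sweep : (I -> Y) -> I * I -> Y)
  (refill : (I * I -> Y) -> I * I -> Y).
Hypothesis cornerX : forall y, X y -> corner y = cst y.
Hypothesis sweepP : is_sweep X corner sweep.
Hypothesis refillP : is_refill X sweep refill.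
Variables (a : Y) (x : Z X).
Hypotheses (Aa : A a) (xE : set_val x = fun=> a).

Lemma deform_polyhedral (B : set Y) (y : 'I_n -> Y) (s : I) :
  (forall b, B b -> B (h (b, s))) -> Z B y -> Z B (fun i => h (y i, s)).
Proof.
move=> hB [t tK yt]; exists t => // i; have := yt i.
by case: ifP => _; [exact: hB|move=> Ai; rewrite hA].
Qed.

Lemma deform_homotopic (B : set Y) (b : Z B) (p p' : {path I from b to b in Z B}) :
  (forall y s, B y -> B (h (y, s))) -> set_val b = (fun=> a) ->
  (forall u i, set_val (p' u) i = h (set_val (p u) i, one)) -> path_homotopic p p'.
Proof.
move=> hB bE p'E.
apply: (polyhedral_path_homotopic (H := fun i z => h (set_val (p z.1) i, z.2))).
- move=> i; apply: comp_continuous => //; apply: pair_continuous; last cont.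
  by apply: coord_set_val_continuous; apply: comp_continuous; [exact: cts_fun|cont].
- by move=> z; apply: deform_polyhedral; [move=> y; exact: hB|exact: set_valP].
- by move=> i u; rewrite h0.
- by move=> i u; rewrite p'E.
- by move=> i u; rewrite /= path_zero bE hA.
- by move=> i u; rewrite /= path_one bE hA.
Qed.

Lemma deform_small (q : I * I -> Z setT) : continuous q ->
  exists k, small_square K A k (fun i z => h (set_val (q z) i, one)).
Proof.
move=> qc; apply: small_square_ex => z.
have [s sK zs] := set_valP (q z); exists s => // i si.
have := zs i; rewrite (negbTE si) => /AN Ni.
have c : continuous (fun z => set_val (q z) i) by exact: coord_set_val_continuous.
apply: (@filterS _ (nbhs z) _ _ _ _ (c z N (open_nbhs_nbhs (conj oN Ni)))).
by move=> z' /= /hN.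
Qed.

Lemma deform_coord_continuous (S : topologicalType) (B : set Y) (q : S -> Z B) i :
  continuous q -> continuous (fun z => h (set_val (q z) i, one)).
Proof.
move=> qc; apply: comp_continuous => //; apply: pair_continuous; last cont.
exact: coord_set_val_continuous.
Qed.

(** The loop is first deformed by h, so that it becomes small, and then swept.
*)
Lemma polyhedral_pi1_surj (p : {path I from polyhedral_incl x to polyhedral_incl x in Z setT}) :
  exists r : {path I from x to x in Z X}, path_homotopic (polyhedral_incl \o r) p.
Proof.
pose p' i t := h (set_val (p t) i, one).
have p'c i : continuous (p' i) by apply: deform_coord_continuous; exact: cts_fun.
have yE : set_val (polyhedral_incl x) = fun=> a by [].
have p'0 i : p' i zero = a by rewrite /p' path_zero yE hA.
have p'1 i : p' i one = a by rewrite /p' path_one yE hA.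
have [||||P' P'E] := @polyhedral_path setT (polyhedral_incl x) (polyhedral_incl x) p'.
- exact: p'c.
- by move=> u; apply: deform_polyhedral => //; exact: set_valP.
- by move=> i; rewrite p'0 yE.
- by move=> i; rewrite p'1 yE.
have [|k sq] := @deform_small (fun z => p z.1).
  by apply: comp_continuous; [exact: cts_fun|cont].
have sp : small_path K A k p' by exact: small_square_path.
have [ZY ZX] := sweep_iter_polyhedral sweepP AX p'c sp.
have sP i := sweep_iterP sweepP k (p'c i).
have ca : corner a = cst a by rewrite cornerX//; exact: AX.
have [||||r rE] := @polyhedral_path X x x (fun i u => sweep_iter sweep k (p' i) (u, one)).
- move=> i; have [c _ _ _] := sP i.
  by apply: (@comp_continuous _ _ _ (sweep_iter sweep k (p' i)) (fun u => (u, one))) => //; cont.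
- exact: ZX.
- by move=> i; have [_ _ _ [_ -> _]] := sP i; rewrite p'0 ca xE.
- by move=> i; have [_ _ _ [_ _ ->]] := sP i; rewrite p'1 ca xE.
exists r; apply: (@path_homotopic_trans _ _ _ _ _ P'); last first.
  by apply: path_homotopic_sym; exact: deform_homotopic P'E.
apply: path_homotopic_sym.
apply: (polyhedral_path_homotopic (H := fun i => sweep_iter sweep k (p' i))).
- by move=> i; have [] := sP i.
- exact: ZY.
- by move=> i u; have [_ _ _ [-> _ _]] := sP i; rewrite P'E.
- by move=> i u; rewrite -rE.
- by move=> i u; have [_ _ _ [_ -> _]] := sP i; rewrite p'0 ca yE.
- by move=> i u; have [_ _ _ [_ _ ->]] := sP i; rewrite p'1 ca yE.
Qed.

(** The homotopy is deformed by h and refilled.  Its boundary stays in X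
throughout, hence is not changed by the refilling and consists of the deformed
loops, which are homotopic in Z(X) to the given ones because h preserves X. *)
Lemma polyhedral_pi1_inj (p q : {path I from x to x in Z X}) :
  path_homotopic (polyhedral_incl \o p) (polyhedral_incl \o q) -> path_homotopic p q.
Proof.
move=> [H [Hc H0 H1 Hx Hy]].
have deform (r : {path I from x to x in Z X}) : exists r' : {path I from x to x in Z X},
    path_homotopic r r' /\ forall u i, set_val (r' u) i = h (set_val (r u) i, one).
  have [||||r' r'E] := @polyhedral_path X x x (fun i t => h (set_val (r t) i, one)).
  - by move=> i; apply: deform_coord_continuous; exact: cts_fun.
  - by move=> u; apply: deform_polyhedral; [move=> y; exact: hX|exact: set_valP].
  - by move=> i; rewrite path_zero xE hA.
  - by move=> i; rewrite path_one xE hA.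
  by exists r'; split=> //; apply: deform_homotopic r'E.
have [p' [pp' p'E]] := deform p; have [q' [qq' q'E]] := deform q.
apply: path_homotopic_trans pp' _; apply: path_homotopic_trans (path_homotopic_sym qq').
have [k sq] := deform_small Hc.
pose G i z := h (set_val (H z) i, one).
have Gc i : continuous (G i) by exact: deform_coord_continuous.
have rP i := refill_iterP refillP k (Gc i).
have edge (r : I -> Y) u : continuous r -> (forall u, X (r u)) ->
    sweep_iter sweep k r (u, one) = r u.
  by move=> rc rX; have [_ _ e _] := sweep_iterP sweepP k rc; rewrite e.
have pX (r : I -> Z X) u i : X (h (set_val (r u) i, one)).
  apply: hX; have [s sK zs] := set_valP (r u); have := zs i.
  by case: ifP => // _; exact: AX.
have yE : set_val (polyhedral_incl x) = fun=> a by [].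
have Xa : X a := AX Aa.
apply: (polyhedral_path_homotopic (H := fun i => refill_iter refill k (G i))).
- by move=> i; have [[]] := rP i.
- by apply: (refill_iter_polyhedral refillP AX).
- move=> i u; have [_ [-> _ _ _]] := rP i; rewrite p'E edge.
  + by rewrite /G H0.
  + by have := Gc i => ?; cont.
  + by move=> v; rewrite /G H0; exact: pX.
- move=> i u; have [_ [_ -> _ _]] := rP i; rewrite q'E edge.
  + by rewrite /G H1.
  + by have := Gc i => ?; cont.
  + by move=> v; rewrite /G H1; exact: pX.
- move=> i u; have [_ [_ _ -> _]] := rP i.
  rewrite edge ?xE.
  + by rewrite /G Hx yE hA.
  + by have := Gc i => ?; cont.
  + by move=> v; rewrite /G Hx yE hA.
- move=> i u; have [_ [_ _ _ ->]] := rP i.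
  rewrite edge ?xE.
  + by rewrite /G Hy yE hA.
  + by have := Gc i => ?; cont.
  + by move=> v; rewrite /G Hy yE hA.
Qed.

Lemma polyhedral_pi1_bij : bijective (pi1_map R polyhedral_incl x).
Proof.
have surj u : exists v, pi1_map R polyhedral_incl x v = u.
  elim/pi1_ind : u => p; have [r rp] := polyhedral_pi1_surj p.
  by exists (loop_class r); rewrite pi1_mapE; apply/loop_classP.
have inj : injective (pi1_map R polyhedral_incl x).
  elim/pi1_ind => p; elim/pi1_ind => q.
  by rewrite !pi1_mapE => /loop_classP/polyhedral_pi1_inj/loop_classP.
have gK u := projT2 (cid (surj u)).
by exists (fun u => projT1 (cid (surj u))) => // v; apply: inj.
Qed.

End deformation.

Lemma group_isomorphic_pi1_map (y : Z setT) (x : Z X) :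
  polyhedral_incl x = y -> bijective (pi1_map R polyhedral_incl x) ->
  group_isomorphic (pi1 R x) (pi1 R y).
Proof. by move=> <- bij; exists (pi1_map R polyhedral_incl x). Qed.

End polyhedral_inclusion.

Theorem lemma1p5 (R : realType) (n : nat) (K : simplicial_complex n)
    (Y : topologicalType) (cwY : cw_structure R Y) (X A : set Y)
    (subX : subcomplex cwY X) (subA : subcomplex cwY A) (AX : A `<=` X)
    (discrA : discrete_subspace A)
    (pathX : path_connected R X) (pathY : path_connected R Y)
    (x0 : X) (Ax0 : A (set_val x0))
    (pi1XY : bijective (pi1_map R (subspace_incl X) x0)) :
  group_isomorphic (pi1 R (polyhedral_base K X Ax0))
                   (pi1 R (polyhedral_base K [set: Y] Ax0)).
Proof.
have [h [N [hc h0 hA hX [oN AN hN]]]] := subcomplex_retraction subX subA.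
have pX y : X y -> exists2 d : unit_interval R -> Y,
    maps_in X d & d zero = set_val x0 /\ d one = y.
  move=> Xy; have [p] := pathX x0 (exist _ y (mem_set Xy)).
  exists (fun u => set_val (p u)).
    split=> [|u]; last exact: set_valP.
    by apply: comp_continuous; [exact: set_val_continuous|exact: cts_fun].
  by rewrite path_zero path_one.
have pY y : exists2 d : unit_interval R -> Y,
    continuous d & d zero = set_val x0 /\ d one = y.
  have [p] := pathY (set_val x0) y.
  by exists p; [exact: cts_fun|rewrite path_zero path_one].
have [corner [sweep [refill [cP sP rP]]]] :=
  straightening_exists pX pY (pi1_surj pi1XY) (pi1_inj pi1XY).
apply: group_isomorphic_pi1_map; last first.
  exact: (polyhedral_pi1_bij AX hc h0 hA hX oN AN hN cP sP rP Ax0).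
by apply: val_inj.
Qed.
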